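(* The topological universal cover $\widetilde{\mathrm{SL}_2(\mathbb{R})}$ of $\mathrm{SL}_2(\mathbb{R})$, regarded as an abstract group, is type-absolutely connected, but not absolutely connected.
   Context: A subset $P$ of a group $G$ is $n$-thick ($n\in\mathbb{N}$) if $P=P^{-1}$ and for every sequence $g_1,\dots,g_n$ in $G$ (not necessarily distinct) there are $1\le i<j\le n$ with $g_i^{-1}g_j\in P$; thick means $n$-thick for some $n\in\mathbb{N}$. $P^n$ denotes the set of products $p_1\cdots p_n$ with $p_i\in P$. A group $G$ is $n$-absolutely connected if $P^n=G$ for every thick $P\subseteq G$, and absolutely connected if it is $n$-absolutely connected for some $n\in\mathbb{N}$. A group $G$ is type-absolutely connected if for any sufficiently saturated elementary extension $G^*$ of any first-order expansion of $G$, one has $G^*={G^*}^{00}_G$, where ${G^*}^{00}_G$ is the smallest subgroup of $G^*$ of bounded index type-definable over $G$. Equivalently, for every family $\{P_n:n\in\mathbb{N}\}$ of thick subsets of $G$ with $P_{n+1}P_{n+1}\subseteq P_n$ for all $n$, one has $P_n=G$ for all $n$. *)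

(* Defs.v *)
From HB Require Import structures.
From mathcomp Require Import all_boot all_order all_algebra generic_quotient.
From mathcomp Require Import all_classical all_reals.
From mathcomp Require Import topology normedtype.

Set Implicit Arguments.
Unset Strict Implicit.
Unset Printing Implicit Defensive.

Import Order.TTheory GRing.Theory Num.Theory.
Import numFieldNormedType.Exports.

Local Open Scope classical_set_scope.
Local Open Scope card_scope.

Section Thick.
Local Open Scope group_scope.
Variable G : groupType.
Implicit Types P H : set G.

Definition n_thick (n : nat) P : Prop :=
  P = [set g | P g^-1] /\
  forall g : 'I_n -> G, exists i j : 'I_n, (i < j)%N /\ P ((g i)^-1 * g j).

Definition thick P : Prop := exists n : nat, n_thick n P.

Definition set_power P (n : nat) : set G :=
  [set x | exists p : 'I_n -> G, (forall i, P (p i)) /\ x = \prod_(i < n) p i].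

Definition n_absolutely_connected (n : nat) : Prop :=
  forall P, thick P -> set_power P n = [set: G].

Definition absolutely_connected : Prop :=
  exists n : nat, n_absolutely_connected n.

Definition is_subgroup H : Prop :=
  [/\ H 1, forall x y, H x -> H y -> H (x * y) & forall x, H x -> H x^-1].

Definition left_cosets H : set (set G) :=
  [set C | exists x : G, C = [set x * h | h in H]].

End Thick.

(* The language of an expansion of a group consists of the group symbols, which
   are the constructors One, Inv and Mul of [term], and of the additional
   symbols listed in [language]. *)
Record language := Language {
  fsym : Type;
  farity : fsym -> nat;
  rsym : Type;
  rarity : rsym -> nat }.

(* [term L n] and [formula L n] have their free variables in 'I_n; a quantifier
   binds variable 0 and shifts the others. *)
Inductive term (L : language) (n : nat) : Type :=
| Var of 'I_n
| One
| Inv of term L n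
| Mul of term L n & term L n
| App (f : fsym L) of ('I_(farity f) -> term L n).

Inductive formula (L : language) : nat -> Type :=
| Eq n of term L n & term L n : formula L n
| Rel n (r : rsym L) of ('I_(rarity r) -> term L n) : formula L n
| Neg n of formula L n : formula L n
| And n of formula L n & formula L n : formula L n
| Ex n of formula L n.+1 : formula L n.

Record expansion (L : language) (M : groupType) := Expansion {
  finterp : forall f : fsym L, ('I_(farity f) -> M) -> M;
  rinterp : forall r : rsym L, ('I_(rarity r) -> M) -> Prop }.

Definition env_cons (T : Type) (n : nat) (a : T) (v : 'I_n -> T) :
    'I_n.+1 -> T :=
  fun i => if unlift ord0 i is Some j then v j else a.

Section Semantics.
Variables (L : language) (M : groupType) (S : expansion L M).

Fixpoint eval n (v : 'I_n -> M) (t : term L n) : M :=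
  match t with
  | Var i => v i
  | One => 1%g
  | Inv u => (eval v u)^-1%g
  | Mul u w => (eval v u * eval v w)%g
  | App f ts => finterp S (fun i : 'I_(farity f) => eval v (ts i))
  end.

Fixpoint holds n (phi : formula L n) : ('I_n -> M) -> Prop :=
  match phi in formula _ n return ('I_n -> M) -> Prop with
  | Eq _ t u => fun v => eval v t = eval v u
  | Rel _ r ts => fun v => rinterp S (fun i : 'I_(rarity r) => eval v (ts i))
  | Neg _ psi => fun v => ~ holds psi v
  | And _ psi chi => fun v => holds psi v /\ holds chi v
  | Ex _ psi => fun v => exists a : M, holds psi (env_cons a v)
  end.

Definition definable (A : set M) (D : set M) : Prop :=
  exists (n : nat) (phi : formula L n.+1) (a : 'I_n -> M),
    (forall i, A (a i)) /\ D = [set x | holds phi (env_cons x a)].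

Definition type_definable (A : set M) (X : set M) : Prop :=
  exists F : set (set M), F `<=` definable A /\ X = \bigcap_(D in F) D.

End Semantics.

Definition elementary (L : language) (G M : groupType) (SG : expansion L G)
    (SM : expansion L M) (e : G -> M) : Prop :=
  forall (n : nat) (phi : formula L n) (v : 'I_n -> G),
    holds SG phi v <-> holds SM phi (e \o v).

Definition card_lt (T U : Type) (A : set T) (B : set U) : Prop :=
  A #<= B /\ ~ (B #<= A).

(* Cardinals are represented by types: K stands for kappa = |K|. *)
Definition saturated (K : Type) (L : language) (M : groupType)
    (S : expansion L M) : Prop :=
  forall A : set M, card_lt A [set: K] ->
  forall F : set (set M), F `<=` definable S A ->
  (forall F' : set (set M), finite_set F' -> F' `<=` F ->
     \bigcap_(D in F') D !=set0) ->
  \bigcap_(D in F) D !=set0.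

(* The smallest subgroup of index < |K| that is type-definable over A is the
   intersection of all of them; in a |K|-saturated M with |K| > 2^(|A|+|L|+aleph0)
   the intersection is again such a subgroup. *)
Definition component00 (K : Type) (L : language) (M : groupType)
    (S : expansion L M) (A : set M) : set M :=
  \bigcap_(H in [set H : set M | [/\ is_subgroup H, type_definable S A H &
                                     card_lt (left_cosets H) [set: K]]]) H.

(* "Sufficiently saturated" means kappa-saturated for a cardinal
   kappa > 2^(|G|+|L|+aleph0), and "bounded" means < kappa. *)
Definition type_absolutely_connected (G : groupType) : Prop :=
  forall (L : language) (SG : expansion L G)
    (M : groupType) (SM : expansion L M) (e : G -> M) (K : Type),
  elementary SG SM e ->
  card_lt [set: set (G + (fsym L + rsym L) + nat)%type] [set: K] ->
  saturated K SM ->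
  component00 K SM (range e) = [set: M].

Section SL2_maps.
Local Open Scope ring_scope.
Variable R : realType.

Definition unit_interval : set R := `[0, 1].

Definition SL2_valued (T : topologicalType) (A : set T) (f : T -> 'M[R]_2) :
    Prop :=
  {within A, continuous f} /\ forall x, A x -> \det (f x) = 1.

Lemma cvg_mx_coord (U : Type) (F : set_system U) (FF : Filter F)
    (f : U -> 'M[R]_2) (M : 'M[R]_2) :
  (forall i j, (fun x => f x i j) @ F --> M i j) -> f @ F --> M.
Proof.
move=> fM X [P MP PX].
apply: (filterS (P := [set x | forall i j, P i j (f x i j)])).
  by move=> x Px; apply: PX.
apply: filter_forall => i; apply: filter_forall => j.
by apply: (fM i j); apply: MP.
Qed.

Lemma within_mx_coordP (T : topologicalType) (A : set T) (f : T -> 'M[R]_2) :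
  {within A, continuous f} <->
  forall i j, {within A, continuous (fun x => f x i j)}.
Proof.
split=> [cf i j x|cf x]; last first.
  by apply: cvg_mx_coord => i j; apply: (cf i j x).
apply: (continuous_comp (f := f : subspace A -> _) (g := fun M => M i j)).
  exact: cf.
exact: coord_continuous.
Qed.

Lemma SL2_valued_mul (T : topologicalType) (A : set T) (f g : T -> 'M[R]_2) :
  SL2_valued A f -> SL2_valued A g -> SL2_valued A (fun x => f x *m g x).
Proof.
move=> [/within_mx_coordP cf df] [/within_mx_coordP cg dg]; split; last first.
  by move=> x Ax; rewrite det_mulmx df // dg // mulr1.
apply/within_mx_coordP => i j.
rewrite (_ : (fun x => _) = (fun x => f x i 0 * g x 0 j + f x i 1 * g x 1 j)).
  move=> x; apply: cvgD; apply: cvgM;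
  [exact: (cf i 0 x) | exact: (cg 0 j x) | exact: (cf i 1 x) | exact: (cg 1 j x)].
apply/funext => x; rewrite mxE !big_ord_recl big_ord0 addr0.
by congr (_ + f x i _ * g x _ j); apply/val_inj.
Qed.

Lemma SL2_valued_inv (T : topologicalType) (A : set T) (f : T -> 'M[R]_2) :
  SL2_valued A f -> SL2_valued A (fun x => invmx (f x)).
Proof.
move=> [/within_mx_coordP cf df]; split; last first.
  by move=> x Ax; rewrite det_inv df // invr1.
have cadj : {within A, continuous (fun x => \adj (f x))}.
  apply/within_mx_coordP => i j.
  pose s : R := (-1) ^+ (j + i).
  rewrite (_ : (fun x => _) = (fun x => s * f x (lift j 0) (lift i 0))).
    by move=> x; apply: cvgM; [exact: cvg_cst|exact: (cf _ _ x)].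
  by apply/funext => x; rewrite mxE /cofactor det_mx11 !mxE.
apply: (subspace_eq_continuous _ cadj) => x /set_mem Ax.
have ux : f x \in unitmx by rewrite unitmxE df // unitr1.
by rewrite /from_subspace /= /invmx ux df // invr1 scale1r.
Qed.

Lemma SL2_valued1 (T : topologicalType) (A : set T) :
  SL2_valued A (fun=> 1%:M).
Proof. by split=> [x|x _]; [exact: cvg_cst | rewrite det1]. Qed.

Lemma SL2_valued_snd (A B : set R) (f : R -> 'M[R]_2) :
  SL2_valued B f -> SL2_valued (A `*` B) (fun st : R * R => f st.2).
Proof.
move=> [/subspace_continuousP cf df]; split; last by move=> [s t] [_ /df].
apply/subspace_continuousP => -[s t] [As Bt] X /(cf t Bt) /= fX.
exists (setT, [set t | B t -> X (f t)]); first by split => //; exact: filterT.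
by move=> [s' t'] [_ /= Xt'] [_ /Xt'].
Qed.

Record SL2_path := SL2Path {
  path_fun :> R -> 'M[R]_2;
  path_valued : SL2_valued unit_interval path_fun;
  path_start : path_fun 0 = 1%:M }.

(* Homotopy relative to the endpoints; only the values on [0, 1] matter. *)
Definition homotopic (g h : SL2_path) : Prop :=
  exists H : R * R -> 'M[R]_2,
  [/\ SL2_valued (unit_interval `*` unit_interval) H,
      forall t, unit_interval t -> H (0, t) = g t,
      forall t, unit_interval t -> H (1, t) = h t,
      forall s, unit_interval s -> H (s, 0) = 1%:M &
      forall s, unit_interval s -> H (s, 1) = g 1].

Lemma SL2_unitmx (T : topologicalType) (A : set T) (f : T -> 'M[R]_2) x :
  SL2_valued A f -> A x -> f x \in unitmx.
Proof. by case=> _ df /df fx; rewrite unitmxE fx unitr1. Qed.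

Lemma path_unitmx (g : SL2_path) t : unit_interval t -> g t \in unitmx.
Proof. exact/SL2_unitmx/path_valued. Qed.

Lemma unit_interval0 : unit_interval 0.
Proof. by rewrite /unit_interval /= in_itv /= lexx ler01. Qed.

Lemma unit_interval1 : unit_interval 1.
Proof. by rewrite /unit_interval /= in_itv /= lexx ler01. Qed.

Lemma homotopic_end (g h : SL2_path) : homotopic g h -> g 1 = h 1.
Proof.
case=> H [_ _ H1 _ He].
by rewrite -(H1 _ unit_interval1) (He _ unit_interval1).
Qed.

Lemma eq_homotopic (g h : SL2_path) :
  (forall t, unit_interval t -> g t = h t) -> homotopic g h.
Proof.
move=> gh; exists (fun st => g st.2); split => //.
- exact/SL2_valued_snd/path_valued.
- by move=> s _; exact: path_start.
Qed.

Lemma homotopic_refl g : homotopic g g.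
Proof. exact: eq_homotopic. Qed.

Lemma homotopic_sym g h : homotopic g h -> homotopic h g.
Proof.
move=> gh; have e := homotopic_end gh; case: gh => H [VH H0 H1 Hs He].
exists (fun st => g st.2 *m invmx (H st) *m h st.2); split.
- apply: SL2_valued_mul; last exact/SL2_valued_snd/path_valued.
  by apply: SL2_valued_mul (SL2_valued_inv VH); exact/SL2_valued_snd/path_valued.
- by move=> t It /=; rewrite H0 // mulmxV ?mul1mx // path_unitmx.
- by move=> t It /=; rewrite H1 // mulmxKV // path_unitmx.
- by move=> s Is /=; rewrite Hs // !path_start invmx1 !mulmx1.
- move=> s Is /=; rewrite He // mulmxV ?mul1mx //.
  exact/path_unitmx/unit_interval1.
Qed.

Lemma homotopic_trans g h k : homotopic g h -> homotopic h k -> homotopic g k.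
Proof.
move=> gh hk; have e := homotopic_end gh.
case: gh hk => H [VH H0 H1 Hs He] [K [VK K0 K1 Ks Ke]].
exists (fun st => H st *m invmx (h st.2) *m K st); split.
- apply: SL2_valued_mul VK; apply: SL2_valued_mul VH _.
  exact/SL2_valued_inv/SL2_valued_snd/path_valued.
- by move=> t It /=; rewrite H0 // K0 // mulmxKV // path_unitmx.
- by move=> t It /=; rewrite H1 // K1 // mulmxV ?mul1mx // path_unitmx.
- by move=> s Is /=; rewrite Hs // Ks // path_start invmx1 !mulmx1.
- move=> s Is /=; rewrite He // Ke // mulmxKV //.
  exact/path_unitmx/unit_interval1.
Qed.

Lemma path_one_start : (fun _ : R => 1%:M : 'M[R]_2) 0 = 1%:M.
Proof. by []. Qed.

Lemma path_mul_start (g h : SL2_path) : (fun t => g t *m h t) 0 = 1%:M.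
Proof. by rewrite /= !path_start mulmx1. Qed.

Lemma path_inv_start (g : SL2_path) : (fun t => invmx (g t)) 0 = 1%:M.
Proof. by rewrite /= path_start invmx1. Qed.

Definition path_one := SL2Path (SL2_valued1 _) path_one_start.

Definition path_mul (g h : SL2_path) : SL2_path :=
  SL2Path (SL2_valued_mul (path_valued g) (path_valued h)) (path_mul_start g h).

Definition path_inv (g : SL2_path) : SL2_path :=
  SL2Path (SL2_valued_inv (path_valued g)) (path_inv_start g).

Lemma homotopic_mul g g' h h' :
  homotopic g g' -> homotopic h h' -> homotopic (path_mul g h) (path_mul g' h').
Proof.
move=> [H [VH H0 H1 Hs He]] [K [VK K0 K1 Ks Ke]].
exists (fun st => H st *m K st); split=> [|t It|t It|s Is|s Is] /=.
- exact: SL2_valued_mul.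
- by rewrite H0 // K0.
- by rewrite H1 // K1.
- by rewrite Hs // Ks // mulmx1.
- by rewrite He // Ke.
Qed.

Lemma homotopic_inv g g' :
  homotopic g g' -> homotopic (path_inv g) (path_inv g').
Proof.
move=> [H [VH H0 H1 Hs He]].
exists (fun st => invmx (H st)); split=> [|t It|t It|s Is|s Is] /=.
- exact: SL2_valued_inv.
- by rewrite H0.
- by rewrite H1.
- by rewrite Hs // invmx1.
- by rewrite He.
Qed.

HB.instance Definition _ := gen_eqMixin SL2_path.
HB.instance Definition _ := gen_choiceMixin SL2_path.

Definition homotopicb (g h : SL2_path) : bool := `[< homotopic g h >].

Lemma homotopicb_refl : reflexive homotopicb.
Proof. by move=> g; apply/asboolP/homotopic_refl. Qed.

Lemma homotopicb_sym : symmetric homotopicb.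
Proof. by move=> g h; apply/asboolP/asboolP => /homotopic_sym. Qed.

Lemma homotopicb_trans : transitive homotopicb.
Proof.
move=> h g k /asboolP gh /asboolP hk; apply/asboolP.
exact: homotopic_trans gh hk.
Qed.

Canonical homotopic_equiv :=
  EquivRel homotopicb homotopicb_refl homotopicb_sym homotopicb_trans.

End SL2_maps.

(* The universal cover of SL_2(R), as a group: homotopy classes relative to the
   endpoints of paths in SL_2(R) starting at the identity, multiplied pointwise;
   the covering map sends the class of g to g 1. *)
Definition SL2_universal_cover (R : realType) : Type :=
  {eq_quot (homotopic_equiv R)}%qT.

HB.instance Definition _ (R : realType) :=
  Choice.copy (SL2_universal_cover R) {eq_quot (homotopic_equiv R)}%qT.
HB.instance Definition _ (R : realType) :=
  EqQuotient.copy (SL2_universal_cover R) {eq_quot (homotopic_equiv R)}%qT.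

Section Cover.
Local Open Scope quotient_scope.
Variable R : realType.
Local Notation cover := (SL2_universal_cover R).

Definition path_class (g : SL2_path R) : cover := \pi_cover g.

Lemma path_classP (g h : SL2_path R) :
  path_class g = path_class h <-> homotopic g h.
Proof.
split=> [/eqmodP/asboolP //|gh]; exact/eqmodP/asboolP.
Qed.

Lemma path_class_repr (x : cover) : path_class (repr x) = x.
Proof. exact: reprK. Qed.

Definition cover_one : cover := path_class (path_one R).
Definition cover_mul (x y : cover) : cover :=
  path_class (path_mul (repr x) (repr y)).
Definition cover_inv (x : cover) : cover := path_class (path_inv (repr x)).

Lemma cover_mulE (g h : SL2_path R) :
  cover_mul (path_class g) (path_class h) = path_class (path_mul g h).
Proof.
by apply/path_classP/homotopic_mul; apply/path_classP; exact: path_class_repr.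
Qed.

Lemma cover_invE (g : SL2_path R) :
  cover_inv (path_class g) = path_class (path_inv g).
Proof.
by apply/path_classP/homotopic_inv/path_classP; exact: path_class_repr.
Qed.

Lemma cover_mulA : associative cover_mul.
Proof.
move=> x y z; rewrite -(path_class_repr x) -(path_class_repr y).
rewrite -(path_class_repr z) !cover_mulE.
by apply/path_classP/eq_homotopic => t It /=; rewrite mulmxA.
Qed.

Lemma cover_mul1 : left_id cover_one cover_mul.
Proof.
move=> x; rewrite -(path_class_repr x) cover_mulE.
by apply/path_classP/eq_homotopic => t It /=; rewrite mul1mx.
Qed.

Lemma cover_mulr1 : right_id cover_one cover_mul.
Proof.
move=> x; rewrite -(path_class_repr x) cover_mulE.
by apply/path_classP/eq_homotopic => t It /=; rewrite mulmx1.
Qed.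

Lemma cover_mulV : left_inverse cover_one cover_inv cover_mul.
Proof.
move=> x; rewrite -(path_class_repr x) cover_invE cover_mulE.
by apply/path_classP/eq_homotopic => t It /=; rewrite mulVmx // path_unitmx.
Qed.

Lemma cover_mulrV : right_inverse cover_one cover_inv cover_mul.
Proof.
move=> x; rewrite -(path_class_repr x) cover_invE cover_mulE.
by apply/path_classP/eq_homotopic => t It /=; rewrite mulmxV // path_unitmx.
Qed.

HB.instance Definition _ := isGroup.Build cover
  cover_mulA cover_mul1 cover_mulr1 cover_mulV cover_mulrV.

End Cover.

(* Main.v *)
From HB Require Import structures.
From mathcomp Require Import all_boot all_order all_algebra.
From mathcomp Require Import all_classical all_reals.
From mathcomp Require Import topology normedtype realfun trigo.
From mathcomp Require Import ring lra.
Require Import Defs.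

(** Let G be the universal cover.

    G is type-absolutely connected.  A bounded-index subgroup of a saturated
    extension that is type-definable over G is the intersection of definable
    sets, and by compactness each of these sets starts a chain whose traces
    V_0, V_1, ... on G satisfy V_(n+1)^-1 V_(n+1) <= V_n; each V_n admits a
    finite colouring of G such that a^-1 b lies in V_n whenever a and b have
    the same colour.  The conjugation-invariant cores of the V_n are again
    finitely coloured, so each of them contains some w = h_i^-1 h_j with
    h_i <> h_j in the lifted diagonal torus.  As w rescales the lifted
    unipotent one-parameter groups by a factor different from 1, every
    unipotent element is a quotient of two conjugates of w.  The unipotent
    elements generate G, hence the intersection of the cores is G.

    G is not absolutely connected.  Lifting the argument of the first column
    along a path gives a surjective map q : G -> R which is additive up to an
    error at most pi.  The set of all x with q x close to m Z is thick for
    every m, but for m large its n-th power misses the elements with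
    q x = m / 2. *)

Set Implicit Arguments.
Unset Strict Implicit.
Unset Printing Implicit Defensive.

Import Order.TTheory GRing.Theory Num.Theory.
Import numFieldNormedType.Exports.

Local Open Scope classical_set_scope.
Local Open Scope card_scope.

(** * Definable sets *)

Section Renaming.
Variable L : language.

Fixpoint rename_term n m (f : 'I_n -> 'I_m) (t : term L n) : term L m :=
  match t with
  | Var i => Var L (f i)
  | One => One L m
  | Inv u => Inv (rename_term f u)
  | Mul u w => Mul (rename_term f u) (rename_term f w)
  | App g ts => App (fun i => rename_term f (ts i))
  end.

Definition lift_renaming n m (f : 'I_n -> 'I_m) : 'I_n.+1 -> 'I_m.+1 :=
  env_cons ord0 (lift ord0 \o f).

Fixpoint rename n (phi : formula L n) : forall m, ('I_n -> 'I_m) -> formula L m :=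
  match phi in formula _ n return forall m, ('I_n -> 'I_m) -> formula L m with
  | Eq _ t u => fun _ f => Eq (rename_term f t) (rename_term f u)
  | Rel _ r ts => fun _ f => Rel (fun i => rename_term f (ts i))
  | Neg _ psi => fun _ f => Neg (rename psi f)
  | And _ psi chi => fun _ f => And (rename psi f) (rename chi f)
  | Ex _ psi => fun _ f => Ex (rename psi (lift_renaming f))
  end.

Lemma env_cons0 T n (a : T) (v : 'I_n -> T) : env_cons a v ord0 = a.
Proof. by rewrite /env_cons unlift_none. Qed.

Lemma env_consS T n (a : T) (v : 'I_n -> T) i :
  env_cons a v (lift ord0 i) = v i.
Proof. by rewrite /env_cons liftK. Qed.

Lemma env_cons_lift_renaming T n m (a : T) (v : 'I_m -> T) (f : 'I_n -> 'I_m) :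
  env_cons a v \o lift_renaming f = env_cons a (v \o f).
Proof.
apply/funext => i; rewrite /lift_renaming /=.
by case: (unliftP ord0 i) => [j|] ->; rewrite ?env_consS ?env_cons0 /= ?env_consS.
Qed.

Variables (M : groupType) (S : expansion L M).

Lemma eval_rename n m (f : 'I_n -> 'I_m) (v : 'I_m -> M) (t : term L n) :
  eval S v (rename_term f t) = eval S (v \o f) t.
Proof.
elim: t => //= [t -> //|t -> u -> //|g ts IH].
by congr finterp; apply/funext.
Qed.

Lemma holds_rename n (phi : formula L n) m (f : 'I_n -> 'I_m) (v : 'I_m -> M) :
  holds S (rename phi f) v <-> holds S phi (v \o f).
Proof.
elim: phi m f v => /= {n} [n t u|n r ts|n psi IH|n psi IH chi IH'|n psi IH] m f v.
- by rewrite !eval_rename.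
- by rewrite (_ : (fun i => _) = (fun i => eval S (v \o f) (ts i))) //;
    apply/funext => i; rewrite eval_rename.
- by rewrite IH.
- by rewrite IH IH'.
- by split=> -[a Ha]; exists a; move: Ha; rewrite IH env_cons_lift_renaming.
Qed.

End Renaming.

Section DefinableRelations.
Variables (L : language) (M : groupType) (S : expansion L M).
Implicit Types A B D : set M.

Definition env_cat T k n (w : 'I_k -> T) (a : 'I_n -> T) : 'I_(k + n) -> T :=
  fun i => match fintype.split i with inl j => w j | inr j => a j end.

Lemma env_catl T k n (w : 'I_k -> T) (a : 'I_n -> T) j :
  env_cat w a (lshift n j) = w j.
Proof. by rewrite /env_cat -[lshift _ _]/(unsplit (inl _)) fintype.unsplitK. Qed.

Lemma env_catr T k n (w : 'I_k -> T) (a : 'I_n -> T) j :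
  env_cat w a (rshift k j) = a j.
Proof. by rewrite /env_cat -[rshift _ _]/(unsplit (inr _)) fintype.unsplitK. Qed.

Lemma env_cat_comp T U k n (h : T -> U) (w : 'I_k -> T) (a : 'I_n -> T) :
  h \o env_cat w a = env_cat (h \o w) (h \o a).
Proof. by apply/funext => i; rewrite /env_cat /=; case: fintype.split. Qed.

Lemma env_cat_cons T k n (x : T) (w : 'I_k -> T) (a : 'I_n -> T) :
  env_cat (env_cons x w) a = env_cons x (env_cat w a) :> ('I_(k + n).+1 -> T).
Proof.
apply/funext => i; rewrite -[i in LHS](@fintype.splitK k.+1 n).
case: (@fintype.split k.+1 n i) (@fintype.splitK k.+1 n i) => j /= <-; last first.
  rewrite env_catr (_ : (rshift k.+1 j : 'I_(k + n).+1) = lift ord0 (rshift k j));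
    last exact: val_inj.
  by rewrite env_consS env_catr.
rewrite env_catl; case: (unliftP ord0 j) => [j'|] -> {j}.
  rewrite env_consS (_ : (lshift n (lift ord0 j') : 'I_(k + n).+1) =
    lift ord0 (lshift n j'));
    last exact: val_inj.
  by rewrite env_consS env_catl.
rewrite env_cons0 (_ : (lshift n (ord0 : 'I_k.+1) : 'I_(k + n).+1) = ord0);
  last exact: val_inj.
by rewrite env_cons0.
Qed.

(** [definable] speaks of single elements, whereas the conditions needed later relate two of them.
    Parameters come after the variables, so that a quantifier acts on variable 0. *)
Definition definable_rel A k (Q : ('I_k -> M) -> Prop) : Prop :=
  exists n (phi : formula L (k + n)) (a : 'I_n -> M),
    (forall i, A (a i)) /\ forall w, Q w <-> holds S phi (env_cat w a).

Lemma env_cat1 n (w : 'I_1 -> M) (a : 'I_n -> M) :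
  env_cat w a = env_cons (w ord0) a :> ('I_n.+1 -> M).
Proof.
rewrite (_ : w = env_cons (w ord0) (fun i : 'I_0 => w ord0)); last first.
  by apply/funext => i; rewrite ord1 env_cons0.
rewrite env_cat_cons env_cons0; congr env_cons.
apply/funext => i; rewrite /env_cat; case: fintype.splitP => [[]//|j ij].
by congr a; apply: val_inj.
Qed.

Lemma definableP A D :
  definable S A D <-> definable_rel A (fun w : 'I_1 -> M => D (w ord0)).
Proof.
split=> [[n [phi [a [Aa ->]]]]|[n [phi [a [Aa DP]]]]]; exists n, phi, a; split=> //.
  by move=> w; rewrite env_cat1.
by apply/funext => x; apply/propext; rewrite (DP (fun=> x)) env_cat1.
Qed.

Lemma definable_rel_sub A B k (Q : ('I_k -> M) -> Prop) :
  A `<=` B -> definable_rel A Q -> definable_rel B Q.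
Proof.
by move=> AB [n [phi [a [Aa QP]]]]; exists n, phi, a; split => // i; exact: AB.
Qed.

Lemma definable_relN A k (Q : ('I_k -> M) -> Prop) :
  definable_rel A Q -> definable_rel A (fun w => ~ Q w).
Proof.
by move=> [n [phi [a [Aa QP]]]]; exists n, (Neg phi), a; split=> // w; rewrite QP.
Qed.

Lemma definable_relI A k (P Q : ('I_k -> M) -> Prop) :
  definable_rel A P -> definable_rel A Q -> definable_rel A (fun w => P w /\ Q w).
Proof.
move=> [n [phi [a [Aa PP]]]] [m [psi [b [Ab QP]]]].
pose f : 'I_(k + n) -> 'I_(k + (n + m)) :=
  env_cat (@lshift _ (n + m)) (@rshift k _ \o @lshift _ m).
pose g : 'I_(k + m) -> 'I_(k + (n + m)) :=
  env_cat (@lshift _ (n + m)) (@rshift k _ \o @rshift n _).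
exists (n + m)%N, (And (rename phi f) (rename psi g)), (env_cat a b); split=> [i|w].
  by rewrite /env_cat; case: fintype.split.
rewrite PP QP /= !holds_rename /f /g !env_cat_comp.
suff -> : env_cat w (env_cat a b) \o @lshift _ (n + m) = w.
  suff -> : env_cat w (env_cat a b) \o (@rshift k _ \o @lshift _ m) = a.
    suff -> : env_cat w (env_cat a b) \o (@rshift k _ \o @rshift n _) = b by [].
    by apply/funext => i /=; rewrite env_catr env_catr.
  by apply/funext => i /=; rewrite env_catr env_catl.
by apply/funext => i /=; rewrite env_catl.
Qed.

Lemma definable_rel_ex A k (Q : ('I_k.+1 -> M) -> Prop) :
  definable_rel A Q -> definable_rel A (fun w => exists x, Q (env_cons x w)).
Proof.
move=> [n [phi [a [Aa QP]]]].
exists n, (Ex (phi : formula L (k + n).+1)), a; split=> // w /=.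
by split=> -[x Hx]; exists x; move: Hx; rewrite QP env_cat_cons.
Qed.

Lemma definable_rel_rename A k l (f : 'I_k -> 'I_l) (Q : ('I_k -> M) -> Prop) :
  definable_rel A Q -> definable_rel A (fun w => Q (w \o f)).
Proof.
move=> [n [phi [a [Aa QP]]]].
exists n, (rename phi (env_cat (@lshift _ n \o f) (@rshift l _))), a; split=> // w.
rewrite holds_rename env_cat_comp QP.
suff [-> ->] : env_cat w a \o (@lshift _ n \o f) = w \o f /\
  env_cat w a \o @rshift l _ = a by [].
by split; apply/funext => i /=; rewrite ?env_catl ?env_catr.
Qed.

Lemma definable_rel_const A k b (Q : ('I_k.+1 -> M) -> Prop) :
  A b -> definable_rel A Q -> definable_rel A (fun w => Q (env_cons b w)).
Proof.
move=> Ab [n [phi [a [Aa QP]]]].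
pose f : 'I_(k.+1 + n) -> 'I_(k + n.+1) :=
  env_cat (env_cons (rshift k ord0) (@lshift _ n.+1)) (@rshift k _ \o lift ord0).
exists n.+1, (rename phi f), (env_cons b a); split=> [i|w].
  by case: (unliftP ord0 i) => [j|] ->; rewrite ?env_consS ?env_cons0.
rewrite holds_rename QP /f env_cat_comp.
suff [-> ->] : env_cat w (env_cons b a) \o env_cons (rshift k ord0) (@lshift _ n.+1)
     = env_cons b w /\
   env_cat w (env_cons b a) \o (@rshift k _ \o lift ord0) = a by [].
split; apply/funext => i /=; last by rewrite env_catr env_consS.
by case: (unliftP ord0 i) => [j|] ->;
  rewrite ?env_consS ?env_cons0 ?env_catl ?env_catr ?env_cons0.
Qed.

(** In place of a substitution of terms into formulas, a quantifier asks for some z with z = x^-1 y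
    and [D z]. *)
Lemma definable_rel_divl A D : definable S A D ->
  definable_rel A (fun w : 'I_2 -> M =>
    D ((w ord0)^-1 * w (lift ord0 ord0))%g).
Proof.
move=> /definableP DD.
pose i0 : 'I_3 := ord0.
pose i1 : 'I_3 := lift ord0 (ord0 : 'I_2).
pose i2 : 'I_3 := lift ord0 (lift ord0 ord0 : 'I_2).
have E : definable_rel A (fun w : 'I_3 -> M => w i0 = (w i1)^-1 * w i2)%g.
  exists 0, (Eq (Var L (lshift 0 i0))
     (Mul (Inv (Var L (lshift 0 i1))) (Var L (lshift 0 i2)))),
     (fun=> 1%g); split=> [[]//|w] /=.
  by rewrite !env_catl.
have := definable_rel_ex (definable_relI E (definable_rel_rename (fun=> i0) DD)).
move=> [n [phi [a [Aa QP]]]]; exists n, phi, a; split=> // w; rewrite -QP.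
split=> [H|[x [+ +]]].
  by exists ((w ord0)^-1 * w (lift ord0 ord0))%g;
    rewrite /i0 /i1 /i2 /= !env_consS env_cons0.
by rewrite /i0 /i1 /i2 /= !env_consS env_cons0 => ->.
Qed.

Lemma definable_sub A B D : A `<=` B -> definable S A D -> definable S B D.
Proof. by move=> AB /definableP/(definable_rel_sub AB)/definableP. Qed.

Lemma definableI A D E :
  definable S A D -> definable S A E -> definable S A (D `&` E).
Proof.
by move=> /definableP DD /definableP DE; apply/definableP; exact: definable_relI.
Qed.

Lemma definableT A : definable S A setT.
Proof.
exists 0, (Eq (One L 1) (One L 1)), (fun=> 1%g); split=> [[]//|].
by apply/seteqP; split.
Qed.

Lemma definable_translateC A D b : A b -> definable S A D ->
  definable S A [set y | ~ D (b^-1 * y)%g].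
Proof.
move=> Ab /definable_rel_divl/definable_relN/(definable_rel_const Ab) DD.
apply/definableP; case: DD => n [phi [a [Aa QP]]]; exists n, phi, a; split=> // w.
by rewrite -QP env_cons0 env_consS.
Qed.

Lemma definable_bad_pairs A D E : definable S A D -> definable S A E ->
  definable S A [set x | E x /\ exists y, E y /\ ~ D (x^-1 * y)%g].
Proof.
move=> /definable_rel_divl/definable_relN DD /definableP DE.
(* Under the quantifier variable 0 is the witness y and variable 1 is x, so the pair is read in
   reverse order. *)
pose swap : 'I_2 -> 'I_2 := env_cons (lift ord0 ord0) (fun=> ord0).
have := definable_relI DE (definable_rel_ex (definable_relI
  (definable_rel_rename (fun=> ord0) DE) (definable_rel_rename swap DD))).
move=> [n [phi [a [Aa QP]]]]; apply/definableP; exists n, phi, a; split=> // w.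
rewrite -QP /swap; split=> -[Ew [y Hy]]; split=> //; exists y; move: Hy;
  by rewrite /= !env_consS !env_cons0 !env_consS.
Qed.

End DefinableRelations.

(** * Saturation *)

(** Hilbert's hotel: along an injective sequence [i] in [A], the first [size s] terms go to the
    entries of [s] and the later ones are shifted back. The image of [A] then contains [A] and
    [C]. *)
Lemma card_le_setU_finite (T : Type) (A C : set T) :
  infinite_set A -> finite_set C -> A `|` C #<= A.
Proof.
elim/Ppointed: T => T in A C *; first by rewrite !emptyE_subdef.
move=> /infiniteP/pcard_leP[i] /finite_seqP[s ->].
pose f x := if pselect (exists k, x = i k) is left xi then
    (fun k => if (k < size s)%N then nth point s k else i (k - size s)%N)
      (projT1 (cid xi)) else x.
have fi k : f (i k) = if (k < size s)%N then nth point s k else i (k - size s)%N.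
  rewrite /f; case: pselect => [ik|]; last by case; exists k.
  case: cid => l /= /(@inj _ _ setT i) <- //; exact: in_setT.
apply: card_le_trans (card_image_le f A); apply: subset_card_le => x [Ax|/= xs].
  have [[k xk]|nx] := pselect (exists k, x = i k); last first.
    by exists x => //; rewrite /f; case: pselect.
  exists (i (k + size s)%N); first exact: funS.
  by rewrite fi ltnNge leq_addl /= addnK.
exists (i (index x s)); first exact: funS.
by rewrite fi index_mem xs nth_index.
Qed.

Lemma card_lt_setU_finite (T K : Type) (A C : set T) :
  infinite_set [set: K] -> finite_set C -> card_lt A [set: K] ->
  card_lt (A `|` C) [set: K].
Proof.
move=> Kinf Cfin [AK nKA]; have [Afin|Ainf] := pselect (finite_set A).
  have ACfin : finite_set (A `|` C) by rewrite finite_setU.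
  split; last by move=> /card_le_finite /(_ ACfin).
  have /finite_setP[n /card_eqPle[ACn _]] := ACfin.
  apply: card_le_trans ACn _.
  apply: (@card_le_trans _ _ _ [set: nat]); first exact: card_leT.
  exact/infiniteP.
have ACA := card_le_setU_finite Ainf Cfin.
split; first exact: card_le_trans ACA AK.
by move=> KAC; apply: nKA; exact: card_le_trans ACA.
Qed.

(** By the pigeonhole principle, a symmetric set of this kind is thick. Colourings come directly
    from finite covers by translates, and they combine well when passing to normal cores. *)
Definition finitely_coloured (G : groupType) (V : set G) : Prop :=
  exists (T : finType) (c : G -> T), forall a b, c a = c b -> V (a^-1 * b)%g.

Section Saturation.
Variables (L : language) (M : groupType) (S : expansion L M) (K : Type).
Hypothesis satM : saturated K S.

(** Since [F] is closed under intersection and [X] is monotone, any finitely many sets [X D] contain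
    a common [X E]. Hence nonemptiness of each one yields the finite intersection property. *)
Lemma saturated_directed (A : set M) (F : set (set M)) (X : set M -> set M) :
  card_lt A [set: K] -> F setT -> (forall D E, F D -> F E -> F (D `&` E)) ->
  (forall D E, D `<=` E -> X D `<=` X E) ->
  (forall D, F D -> definable S A (X D)) -> (forall D, F D -> X D !=set0) ->
  exists x, forall D, F D -> X D x.
Proof.
move=> AK FT FI Xmono Xdef Xn0.
have [|F' F'fin F'F|x Hx] := satM AK (F := X @` F).
- by move=> _ [D FD <-]; exact: Xdef.
- suff [E FE XE] : exists2 E, F E & forall D, F' D -> X E `<=` D.
    by have [x XEx] := Xn0 _ FE; exists x => D /XE; exact.
  have /finite_seqP[s F's] := F'fin; move: F'F; rewrite {F' F'fin}F's.
  elim: s => [|D s IH] sF; first by exists setT.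
  have [E FE XE] : exists2 E, F E & forall D', D' \in s -> X E `<=` D'.
    by apply: IH => D' /= D's; apply: sF; rewrite /= inE D's orbT.
  have [D0 FD0 D0D] : (X @` F) D by apply: sF; rewrite /= inE eqxx.
  exists (D0 `&` E) => [|D']; first exact: FI.
  rewrite /= inE => /predU1P[->|D's]; first by rewrite -D0D; apply: Xmono => z [].
  by apply: subset_trans (XE _ D's); apply: Xmono => z [].
- by exists x => D FD; apply: Hx; exists D.
Qed.

Variable A : set M.
Hypothesis AK : forall C, finite_set C -> card_lt (A `|` C) [set: K].
Variable H : set M.
Hypotheses (subH : is_subgroup H) (defH : type_definable S A H).

Let F := [set D | definable S A D /\ H `<=` D].

Let FI D E : F D -> F E -> F (D `&` E).
Proof.
by move=> [dD HD] [dE HE]; split; [exact: definableI|rewrite subsetI].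
Qed.

Let FT : F setT.
Proof. by split=> //; exact: definableT. Qed.

Let FH x : (forall D, F D -> D x) -> H x.
Proof.
move=> Fx; have [F0 [F0d HF0]] := defH; rewrite HF0 => D F0D.
by apply: Fx; split; [exact: F0d|rewrite HF0; exact: bigcap_inf].
Qed.

(** Otherwise compactness gives x and y in [H] with x^-1 y outside [D]. Saturation yields one
    element at a time: first an x with a bad partner in every [E], then, with x as an additional
    parameter, one bad partner y lying in all [E]. *)
Lemma type_definable_subgroup_div D : definable S A D -> H `<=` D ->
  exists E, [/\ definable S A E, H `<=` E &
    forall x y, E x -> E y -> D (x^-1 * y)%g].
Proof.
move=> dD HD; apply: contrapT => nE.
pose X E := [set x | E x /\ exists y, E y /\ ~ D (x^-1 * y)%g].
have [||||E [dE HE]|E [dE HE]|x Xx] := @saturated_directed (A `|` set0) F X.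
- exact/AK/finite_set0.
- exact: FT.
- exact: FI.
- move=> E E' EE' x [Ex [y [Ey nD]]]; split; first exact: EE'.
  by exists y; split=> //; exact: EE'.
- by rewrite setU0; exact: definable_bad_pairs.
- apply: contrapT => X0; apply: nE; exists E; split=> // x y Ex Ey.
  by apply: contrapT => nD; apply: X0; exists x; split=> //; exists y.
have [||||E [dE HE]|E FE|y Yy] :=
    @saturated_directed (A `|` [set x]) F (fun E => E `&` [set y | ~ D (x^-1 * y)%g]).
- exact/AK/finite_set1.
- exact: FT.
- exact: FI.
- by move=> E E' EE' z [Ez nD]; split=> //; exact: EE'.
- apply: definableI; first exact: definable_sub dE.
  by apply: definable_translateC; [right|exact: definable_sub dD].
- by have [_ [y [Ey nD]]] := Xx _ FE; exists y.
have Hx : H x by apply: FH => E /Xx[].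
have Hy : H y by apply: FH => E /Yy[].
have [_ HM HV] := subH.
by have [_] := Yy _ FT; apply; apply: HD; apply: HM => //; exact: HV.
Qed.

(** Let [B] consist of one representative of each left coset of [H]. The translates of [D] by [B]
    cover [M]; if no finitely many did, saturation would give a point outside all of them. *)
Lemma bounded_index_cover D : infinite_set [set: K] ->
  card_lt (left_cosets H) [set: K] -> definable S A D -> H `<=` D ->
  exists s : seq M, forall y, exists2 a, a \in s & D (a^-1 * y)%g.
Proof.
move=> Kinf HK [n [phi [c [Ac Dphi]]]] HD; have [H1 HM HV] := subH.
apply: contrapT => ncov.
pose B := xget 1%g @` left_cosets H.
have BK : card_lt B [set: K].
  case: HK => HK nKH; have BH : B #<= left_cosets H by exact: card_image_le.
  split; first exact: card_le_trans BH HK.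
  by move=> KB; apply: nKH; exact: card_le_trans BH.
(* Only the finitely many parameters of the formula defining [D] are added to [B], so the parameter
   set stays smaller than [K]. *)
have cfin : finite_set (range c) by exact/finite_image/finite_finset.
have dD : definable S (B `|` range c) D.
  by exists n, phi, c; split=> // i; right; exists i.
pose Y a := [set y | ~ D (a^-1 * y)%g].
have [|F' F'fin F'F|y Hy] := satM (card_lt_setU_finite Kinf cfin BK) (F := Y @` B).
- by move=> _ [a Ba <-]; apply: definable_translateC => //; left.
- suff [s sY] : exists s : seq M, forall E, F' E -> exists2 a, a \in s & E = Y a.
    apply: contrapT => F'0; apply: ncov; exists s => y.
    apply: contrapT => nys; apply: F'0; exists y => E /sY[a sa ->] Dy.
    by apply: nys; exists a.
  have /finite_seqP[t F't] := F'fin; move: F'F; rewrite {F' F'fin}F't.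
  elim: t => [|E t IH] tF; first by exists [::].
  have [s sY] : exists s : seq M, forall E', E' \in t -> exists2 a, a \in s & E' = Y a.
    by apply: IH => E' /= E't; apply: tF; rewrite /= inE E't orbT.
  have [a Ba aE] : (Y @` B) E by apply: tF; rewrite /= inE eqxx.
  exists (a :: s) => E'; rewrite /= inE => /predU1P[->|/sY[b bs ->]].
    by exists a; rewrite ?mem_head.
  by exists b; rewrite // inE bs orbT.
pose C := [set (y * h)%g | h in H].
have Cy : C y by exists 1%g; rewrite ?mulg1.
have [h Hh hC] : C (xget 1%g C) by exact: xgetPex (ex_intro _ _ Cy).
have BC : B (xget 1%g C) by exists C => //; exists y.
apply: (Hy (Y (xget 1%g C))); first by exists (xget 1%g C).
by apply: HD; rewrite -hC invgM -mulgA mulVg mulg1; exact: HV.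
Qed.

End Saturation.

(** * Elementary extensions and chains of traces *)

Section ElementaryExtension.
Variables (L : language) (G M : groupType).
Variables (SG : expansion L G) (SM : expansion L M) (e : G -> M).
Hypothesis elem : elementary SG SM e.

Lemma elementaryM a b : e (a * b)%g = (e a * e b)%g.
Proof.
pose v : 'I_3 -> G := env_cons (a * b)%g (env_cons a (fun _ : 'I_1 => b)).
have := elem (Eq (Var L ord0)
  (Mul (Var L (lift ord0 ord0)) (Var L (lift ord0 (lift ord0 ord0))))) v.
by rewrite /= /v !env_consS !env_cons0 => -[/(_ erefl)].
Qed.

Lemma elementaryV a : e a^-1%g = (e a)^-1%g.
Proof.
have e1 : e 1%g = 1%g by apply: (mulgI (e 1%g)); rewrite -elementaryM !mulg1.
by apply: (mulgI (e a)); rewrite -elementaryM !mulgV.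
Qed.

(** The parameters come from [G], so the statement that no element violates [phi] transfers from [G]
    to [M]. *)
Lemma definable_elementaryT D : definable SM (range e) D ->
  (forall x, D (e x)) -> D = setT.
Proof.
move=> [n [phi [a [ea ->]]]] De.
have /choice[b eb] : forall i, exists x, e x = a i.
  by move=> i; have [x _ <-] := ea i; exists x.
have aE : a = e \o b by apply/funext => i; rewrite /= eb.
have := elem (Neg (Ex (Neg phi))) b; rewrite -aE => -[] + _ /=.
have H : ~ exists x, ~ holds SG phi (env_cons x b).
  move=> [x]; apply; apply/elem; have := De x; rewrite /= aE; congr holds.
  by apply/funext => i; rewrite /= /env_cons; case: unlift.
move=> /(_ H) nE; apply/seteqP; split=> // x _ /=.
by apply: contrapT => nphi; apply: nE; exists x.
Qed.

End ElementaryExtension.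

(* A chain of definable sets shrinking to a bounded-index type-definable
   subgroup restricts to a chain in [G]; each member is finitely coloured since
   finitely many translates of the next member cover the extension. *)
Lemma type_absolutely_connected_chain (G : groupType) :
  (forall V : nat -> set G, (forall n, finitely_coloured (V n)) ->
    (forall n a b, V n.+1 a -> V n.+1 b -> V n (a^-1 * b)%g) ->
    forall n x, V n x) ->
  type_absolutely_connected G.
Proof.
move=> chainG L SG M SM e K elem [TK nKT] satM.
apply/seteqP; split=> // m _ H [subH defH HK].
have Kinf : infinite_set [set: K].
  apply/infiniteP; apply: card_le_trans TK; apply/pcard_leTP.
  apply/injPex; exists (fun n => [set inr n]) => // i j _ _ /seteqP[+ _].
  by move=> /(_ (inr i) erefl) [].
have eK : card_lt (range e) [set: K].
  have eT : range e #<= [set: set (G + (fsym L + rsym L) + nat)%type].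
    apply: card_le_trans (card_image_le _ _) _; apply/pcard_leTP.
    apply/injPex; exists (fun x => [set inl (inl x)]) => // i j _ _ /seteqP[+ _].
    by move=> /(_ (inl (inl i)) erefl) [].
  split; first exact: card_le_trans eT TK.
  by move=> Ke; apply: nKT; exact: card_le_trans eT.
have AK C : finite_set C -> card_lt (range e `|` C) [set: K].
  by move=> Cfin; exact: card_lt_setU_finite.
pose F := {D : set M | definable SM (range e) D /\ H `<=` D}.
have /choice[next nextP] : forall D : F, exists E : F,
    forall x y, sval E x -> sval E y -> sval D (x^-1 * y)%g.
  move=> [D [dD HD]].
  have [E [dE HE DE]] := type_definable_subgroup_div satM AK subH defH dD HD.
  by exists (exist _ E (conj dE HE)).
suff FG (D : F) : sval D m.
  have [F0 [F0d HF0]] := defH; rewrite HF0 => D F0D.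
  apply: (FG (exist _ D _)); split; first exact: F0d.
  by rewrite HF0; exact: bigcap_inf.
rewrite (_ : sval D = setT) //; apply: (definable_elementaryT elem (proj1 (svalP D))).
(* The chain starts at [D] itself, so its member 0 on [G] is the trace of [D]. *)
pose U n : F := iter n next D.
apply: (chainG (fun n => e @^-1` sval (U n)) _ _ 0%N) => [n|n a b Ua Ub]; last first.
  by rewrite /preimage /= (elementaryM elem) (elementaryV elem); exact: nextP.
have [dU HU] := svalP (U n.+1).
have [s cov] := bounded_index_cover satM subH Kinf HK dU HU.
(* The colour of an element is the index of the first translate of [U n.+1] containing its image;
   two elements of one translate differ by an element of [U n]. The extra colour keeps the ordinal
   type inhabited for [inord]. *)
pose test x := fun a => `[< sval (U n.+1) (a^-1 * x)%g >].
exists 'I_(size s).+1, (fun g => inord (find (test (e g)) s)) => a b ab.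
have has_test x : has (test x) s.
  by have [a0 a0s Ua0] := cov x; apply/hasP; exists a0 => //; apply/asboolP.
have {}ab : find (test (e a)) s = find (test (e b)) s.
  have := congr1 val ab; rewrite /= !inordK // ltnS; exact: find_size.
have /asboolP Ua := nth_find 1%g (has_test (e a)).
have /asboolP Ub := nth_find 1%g (has_test (e b)).
rewrite /preimage /= (elementaryM elem) (elementaryV elem).
have := nextP _ _ _ Ua; rewrite ab => /(_ _ Ub).
by rewrite invgM invgK -mulgA mulVKg.
Qed.

(** * Normal cores *)

Section NormalCore.
Local Open Scope group_scope.
Variables (G : groupType) (V : nat -> set G).
Hypothesis colV : forall n, finitely_coloured (V n).
Hypothesis divV : forall n a b, V n.+1 a -> V n.+1 b -> V n (a^-1 * b).

Definition conj_invariant (N : set G) := forall x g, N x -> N (g^-1 * x * g).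

Definition core n := [set x | forall g, V n (g^-1 * x * g)].

Let V1 n : V n 1.
Proof. by have [T [c /(_ 1 1 erefl)]] := colV n; rewrite mulVg. Qed.

Let VS n x : V n.+1 x -> V n x.
Proof. by move=> Vx; have := divV (V1 n.+1) Vx; rewrite invg1 mul1g. Qed.

Let conj_div (g a b : G) : (g^-1 * a * g)^-1 * (g^-1 * b * g) = g^-1 * (a^-1 * b) * g.
Proof. by rewrite !invgM invgK -!mulgA mulVKg. Qed.

(* One representative [r t] of each colour [t] suffices: if [g] has colour [t],
   then [g] differs from [r t] by an element of [V n.+2]. *)
Lemma core_finitely_coloured n : finitely_coloured (core n).
Proof.
have [T [c colc]] := colV n.+2.
pose r t := xget 1 [set g | c g = t].
have rP g : V n.+2 ((r (c g))^-1 * g).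
  apply: colc; rewrite /r; by case: xgetP => [y _ ->|/(_ g)/(_ erefl)].
exists {ffun T -> T}, (fun x => [ffun t => c ((r t)^-1 * x * r t)]) => a b ab g.
set p := (r (c g))^-1 * g; have Vp : V n.+2 p := rP g.
set y := (r (c g))^-1 * (a^-1 * b) * r (c g).
have Vy : V n.+2 y.
  by have := congr1 (fun f : {ffun T -> T} => f (c g)) ab;
    rewrite !ffunE => /colc; rewrite conj_div.
(* The conjugate is p^-1 y p with p and y in [V n.+2]; writing it with two divisions costs two
   levels of the chain. *)
have -> : g^-1 * (a^-1 * b) * g = (y^-1 * p)^-1 * p.
  by rewrite /y /p !invgM !invgK -!mulgA !mulVKg.
by apply: divV; [exact: divV|exact: VS].
Qed.

(** The intersection [B] of all cores is a subgroup, since a quotient of two elements of [core n.+1]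
    lies in [core n]. For the same reason, the hypothesis on [X] applied to [core m.+1] puts [X]
    inside [core m]. *)
Lemma chain_generated (X : set G) :
  (forall x N, X x -> finitely_coloured N -> conj_invariant N ->
    exists a b, [/\ N a, N b & x = a^-1 * b]) ->
  (forall B : set G, is_subgroup B -> X `<=` B -> B = setT) ->
  forall n x, V n x.
Proof.
move=> XN genX n x.
pose B := [set x | forall n, core n x].
suff BT : B = setT.
  by have : B x by [rewrite BT]; move=> /(_ n 1); rewrite invg1 mul1g mulg1.
have divB a b : B a -> B b -> B (a^-1 * b).
  by move=> Ba Bb m g; rewrite -conj_div; apply: divV; [exact: Ba|exact: Bb].
have B1 : B 1 by move=> m g; rewrite mulg1 mulVg.
have BV y : B y -> B y^-1 by move=> By; rewrite -[y^-1]mulg1; exact: divB.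
apply: genX => [|y Xy m g].
  by split=> // y z By Bz; rewrite -[y]invgK; apply: divB => //; exact: BV.
have [y' h Ny' k|a [b [Na Nb ->]]] := XN y (core m.+1) Xy (core_finitely_coloured m.+1).
  by have := Ny' (h * k); rewrite invgM !mulgA.
by rewrite -conj_div; exact: divV.
Qed.

End NormalCore.

(** * Continuation along families of matrices *)

Lemma continuous_within_comp (T U W : topologicalType) (A : set U) (c : T -> U)
    (f : U -> W) :
  continuous c -> (forall x, A (c x)) -> {within A, continuous f} ->
  continuous (f \o c).
Proof.
move=> cc Ac /subspace_continuousP cf x X /(cf _ (Ac x)) fX.
have /= := cc x _ fX; rewrite /nbhs /=; apply: filterS => y; exact.
Qed.

Lemma continuous_pair (T U W : topologicalType) (f : T -> U) (g : T -> W) x :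
  {for x, continuous f} -> {for x, continuous g} ->
  {for x, continuous (fun y => (f y, g y))}.
Proof. by move=> cf cg; exact: (cvg_pair cf cg). Qed.

Lemma fst_continuous (T U : topologicalType) : continuous (@fst T U).
Proof. by move=> [x y]; exact: cvg_fst. Qed.

Lemma snd_continuous (T U : topologicalType) : continuous (@snd T U).
Proof. by move=> [x y]; exact: cvg_snd. Qed.

Section Matrices.
Local Open Scope ring_scope.
Variable R : realType.

Definition mx2 (a b c d : R) : 'M[R]_2 :=
  \matrix_(i, j) if i == 0 then if j == 0 then a else b
                 else if j == 0 then c else d.

Lemma ord2P (P : 'I_2 -> Prop) : P 0 -> P 1 -> forall i, P i.
Proof.
move=> P0 P1 i; case: (unliftP 0 i) => [j|] -> //.
by rewrite (_ : lift 0 j = 1) //; apply: val_inj; rewrite /= ord1.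
Qed.

Lemma mx2_eta (A : 'M[R]_2) : A = mx2 (A 0 0) (A 0 1) (A 1 0) (A 1 1).
Proof.
by apply/matrixP => i j; rewrite mxE; elim/ord2P: i; elim/ord2P: j.
Qed.

Lemma mulmx2E (A B : 'M[R]_2) i j :
  (A *m B) i j = A i 0 * B 0 j + A i 1 * B 1 j.
Proof.
rewrite mxE !big_ord_recl big_ord0 addr0.
by congr (_ + A i _ * B _ j); apply: val_inj.
Qed.

Lemma mulmx2 a b c d a' b' c' d' :
  mx2 a b c d *m mx2 a' b' c' d' =
  mx2 (a * a' + b * c') (a * b' + b * d') (c * a' + d * c') (c * b' + d * d').
Proof.
by apply/matrixP => i j; rewrite mulmx2E !mxE; elim/ord2P: i; elim/ord2P: j.
Qed.

Lemma det_mx2 a b c d : \det (mx2 a b c d) = a * d - b * c.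
Proof.
rewrite (expand_det_row _ 0) !big_ord_recl big_ord0 addr0 /cofactor !det_mx11 !mxE /=.
by rewrite expr0 expr1 mul1r mulN1r mulrN.
Qed.

Lemma mx2_1 : 1%:M = mx2 1 0 0 1.
Proof. by apply/matrixP => i j; rewrite !mxE; elim/ord2P: i; elim/ord2P: j. Qed.

Lemma det2E (A : 'M[R]_2) : \det A = A 0 0 * A 1 1 - A 0 1 * A 1 0.
Proof. by rewrite {1}(mx2_eta A) det_mx2. Qed.

Lemma invmx2 (A : 'M[R]_2) : \det A = 1 ->
  invmx A = mx2 (A 1 1) (- A 0 1) (- A 1 0) (A 0 0).
Proof.
move=> dA; have uA : A \in unitmx by rewrite unitmxE dA unitr1.
apply: (can_inj (mulKmx uA)); rewrite mulmxV // {1}(mx2_eta A) mulmx2 mx2_1.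
move: dA; rewrite det2E => dA.
by congr mx2; rewrite -?[LHS]dA; ring.
Qed.

(** Paths and homotopies are controlled only over the unit interval; composing with this retraction
    makes them continuous on the whole line or plane. *)
Definition clamp (t : R) : R := Num.max 0 (Num.min 1 t).

Lemma clamp_unit_interval t : unit_interval (clamp t).
Proof.
by rewrite /unit_interval /= in_itv /= le_max lexx /= ge_max ler01 /= ge_min lexx.
Qed.

Lemma clamp_id t : unit_interval t -> clamp t = t.
Proof.
by rewrite /unit_interval /= in_itv /= /clamp => /andP[t0 t1]; rewrite min_r // max_r.
Qed.

Lemma continuous_clamp : continuous clamp.
Proof.
move=> x; apply: continuous_max; first exact: cst_continuous.
by apply: continuous_min; [exact: cst_continuous|exact: cvg_id].
Qed.

Lemma clamp0 : clamp 0 = 0.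
Proof. exact/clamp_id/unit_interval0. Qed.

Lemma clamp1 : clamp 1 = 1.
Proof. exact/clamp_id/unit_interval1. Qed.

Lemma mx_continuousP (T : topologicalType) (f : T -> 'M[R]_2) :
  continuous f <-> forall i j, continuous (fun x => f x i j).
Proof.
split=> [cf i j x|cf x]; last by apply: cvg_mx_coord => i j; exact: cf.
by apply: (continuous_comp (f := f) (g := fun M => M i j));
  [exact: cf|exact: coord_continuous].
Qed.

(* The first two conditions keep the corner entry of [A^-1 B] and of [B^-1 A]
   invertible, the third one bounds the angle between the first columns of [A]
   and [B] by [pi / 2]. *)
Definition near_mx (A B : 'M[R]_2) : Prop :=
  [/\ 0 < A 1 1 * B 0 0 - A 0 1 * B 1 0,
      0 < B 1 1 * A 0 0 - B 0 1 * A 1 0 &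
      0 < A 0 0 * B 0 0 + A 1 0 * B 1 0].

Lemma near_mxC A B : near_mx A B -> near_mx B A.
Proof. by case=> h1 h2 h3; split=> //; rewrite [B 0 0 * _]mulrC [B 1 0 * _]mulrC. Qed.

Lemma col0_sqr_gt0 (A : 'M[R]_2) : \det A = 1 -> 0 < A 0 0 ^+ 2 + A 1 0 ^+ 2.
Proof.
rewrite det2E => dA; rewrite lt_neqAle addr_ge0 ?sqr_ge0 // andbT.
apply/eqP => /esym/eqP; rewrite paddr_eq0 ?sqr_ge0 // !sqrf_eq0.
move=> /andP[/eqP a0 /eqP c0]; move: dA; rewrite a0 c0 mul0r mulr0 subr0.
by move/esym/eqP; rewrite oner_eq0.
Qed.

Section Continuation.
Variable H : R * R -> 'M[R]_2.
Hypotheses (cH : continuous H) (dH : forall z, \det (H z) = 1).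

(** Tube lemma: [near_mx] is an open condition that relates each matrix of determinant 1 to itself,
    and compactness of the interval makes the neighbourhood of [s0] uniform in t. *)
Lemma near_mx_tube s0 :
  \forall s \near s0, forall t, unit_interval t -> near_mx (H (s0, t)) (H (s, t)).
Proof.
have cHij i j : continuous (fun z => H z i j) by have /mx_continuousP := cH; exact.
have /compact_near_coveringP cover := @segment_compact R 0 1.
apply: (cover _ (nbhs s0) (fun s t => near_mx (H (s0, t)) (H (s, t)))) => t0 _.
pose z0 : R * R := (t0, s0).
have cA i j : {for z0, continuous (fun z : R * R => H (s0, z.1) i j)}.
  apply: (continuous_comp (f := fun z : R * R => (s0, z.1)) (g := fun z => H z i j)).
    by apply: continuous_pair; [exact: cst_continuous|exact: fst_continuous].
  exact: cHij.
have cB i j : {for z0, continuous (fun z : R * R => H (z.2, z.1) i j)}.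
  apply: (continuous_comp (f := fun z : R * R => (z.2, z.1)) (g := fun z => H z i j)).
    by apply: continuous_pair; [exact: snd_continuous|exact: fst_continuous].
  exact: cHij.
have dd := dH (s0, t0); rewrite det2E in dd.
have h1 : \forall z \near z0, 0 < H (s0, z.1) 1 1 * H (z.2, z.1) 0 0
                                - H (s0, z.1) 0 1 * H (z.2, z.1) 1 0.
  apply: (cvgr_gt _ (cvgB (cvgM (cA 1 1) (cB 0 0)) (cvgM (cA 0 1) (cB 1 0)))).
  by rewrite /= [X in X - _]mulrC dd ltr01.
have h2 : \forall z \near z0, 0 < H (z.2, z.1) 1 1 * H (s0, z.1) 0 0
                                - H (z.2, z.1) 0 1 * H (s0, z.1) 1 0.
  apply: (cvgr_gt _ (cvgB (cvgM (cB 1 1) (cA 0 0)) (cvgM (cB 0 1) (cA 1 0)))).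
  by rewrite /= [X in X - _]mulrC dd ltr01.
have h3 : \forall z \near z0, 0 < H (s0, z.1) 0 0 * H (z.2, z.1) 0 0
                                + H (s0, z.1) 1 0 * H (z.2, z.1) 1 0.
  apply: (cvgr_gt _ (cvgD (cvgM (cA 0 0) (cB 0 0)) (cvgM (cA 1 0) (cB 1 0)))).
  by rewrite /= -!expr2 col0_sqr_gt0.
have h : nbhs z0 [set z | near_mx (H (s0, z.1)) (H (z.2, z.1))].
  by apply: filterS3 h1 h2 h3 => z; split.
exact: h.
Qed.

(** As [near_mx] is symmetric, [Psi] is locally constant, hence constant on the connected line. *)
Lemma continuation (Psi : R -> Prop) :
  (forall s s', (forall t, unit_interval t -> near_mx (H (s, t)) (H (s', t))) ->
     Psi s -> Psi s') ->
  Psi 0 -> Psi 1.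
Proof.
move=> step Psi0.
have step_near s0 : \forall s \near s0, Psi s <-> Psi s0.
  apply: filterS (near_mx_tube s0) => s Hs; split; apply: step => t It.
    exact/near_mxC/Hs.
  exact: Hs.
have /connected_intervalP connR : is_interval [set: R] by [].
suff /seteqP[_ /(_ 1)] : [set s | Psi s] = setT by exact.
apply: connR; first by exists 0.
- exists [set s | Psi s]; last by rewrite setTI.
  by rewrite openE => s Ps; apply: filterS (step_near s) => s' /= ->.
- exists [set s | Psi s]; last by rewrite setTI.
  rewrite -openC openE => s nPs; apply: filterS (step_near s) => s' /= PP.
  by rewrite /setC /= PP.
Qed.

End Continuation.
End Matrices.

(** * Generation of the cover by unipotents *)

Section CoverGeneration.
Local Open Scope ring_scope.
Variable R : realType.
Local Notation cover := (SL2_universal_cover R).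

Lemma SL2_valued_continuous (T : topologicalType) (A : set T) (f : T -> 'M[R]_2) :
  continuous f -> (forall t, \det (f t) = 1) -> SL2_valued A f.
Proof. by move=> cf df; split=> // x; exact: continuous_subspaceT. Qed.

Definition path_of (f : R -> 'M[R]_2) (cf : continuous f)
    (df : forall t, \det (f t) = 1) (f0 : f 0 = 1%:M) : SL2_path R :=
  SL2Path (SL2_valued_continuous _ cf df) f0.

Lemma eq_path_class (g h : SL2_path R) :
  (forall t, unit_interval t -> g t = h t) -> path_class g = path_class h.
Proof. by move=> gh; apply/path_classP/eq_homotopic. Qed.

Lemma path_classM (g h : SL2_path R) :
  (path_class g * path_class h)%g = path_class (path_mul g h).
Proof. exact: cover_mulE. Qed.

Lemma path_classV (g : SL2_path R) :
  (path_class g)^-1%g = path_class (path_inv g).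
Proof. exact: cover_invE. Qed.

Lemma path_clamp_continuous (g : SL2_path R) : continuous (g \o @clamp R).
Proof.
apply: continuous_within_comp (proj1 (path_valued g)).
  exact: continuous_clamp.
exact: clamp_unit_interval.
Qed.

Lemma path_det (g : SL2_path R) t : unit_interval t -> \det (g t) = 1.
Proof. by move=> It; case: (path_valued g) => _; exact. Qed.

(** Continuation along the slices of [H], extended to the plane by [clamp]. A slice is represented
    by any path agreeing with it on the unit interval. *)
Lemma family_ind (H : R * R -> 'M[R]_2) (Phi : SL2_path R -> Prop) :
  SL2_valued (@unit_interval R `*` @unit_interval R) H ->
  (forall s, unit_interval s -> H (s, 0) = 1%:M) ->
  (forall s s' (p p' : SL2_path R), unit_interval s -> unit_interval s' ->
    (forall t, unit_interval t -> p t = H (s, t)) ->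
    (forall t, unit_interval t -> p' t = H (s', t)) ->
    (forall t, unit_interval t -> near_mx (p t) (p' t)) -> Phi p -> Phi p') ->
  forall p p' : SL2_path R, (forall t, unit_interval t -> p t = H (0, t)) ->
    (forall t, unit_interval t -> p' t = H (1, t)) -> Phi p -> Phi p'.
Proof.
move=> [cH dH] H0 step p p' pH p'H.
pose cl (z : R * R) := (clamp z.1, clamp z.2).
have clI z : (@unit_interval R `*` @unit_interval R) (cl z).
  by split; exact: clamp_unit_interval.
have cHcl : continuous (H \o cl).
  apply: continuous_within_comp clI cH => z.
  by apply: (continuous_pair (f := fun z : R * R => clamp z.1)
    (g := fun z : R * R => clamp z.2)); apply: continuous_comp;
    [exact: fst_continuous|exact: continuous_clamp|
     exact: snd_continuous|exact: continuous_clamp].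
have dHcl z : \det ((H \o cl) z) = 1 by exact: dH.
have near_self (q : SL2_path R) t : unit_interval t -> near_mx (q t) (q t).
  move=> It; have dq := path_det q It; have := col0_sqr_gt0 dq.
  by move: dq; rewrite det2E mulrC => dq c0; split; rewrite // dq ltr01.
pose Psi s := forall q : SL2_path R,
  (forall t, unit_interval t -> q t = H (clamp s, t)) -> Phi q.
move=> Phip; suff : Psi 1 by apply=> t It; rewrite clamp1 p'H.
apply: (continuation cHcl dHcl (Psi := Psi)).
  move=> s s' close Ps q qH.
  have cs : continuous (fun t => (H \o cl) (s, t)).
    move=> t; apply: (continuous_comp (f := fun t => (s, t))); last exact: cHcl.
    by apply: continuous_pair; [exact: cst_continuous|exact: cvg_id].
  have s0 : (H \o cl) (s, 0) = 1%:M.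
    by rewrite /= /cl /= clamp0 H0 //; exact: clamp_unit_interval.
  pose r := path_of cs (fun t => dHcl (s, t)) s0.
  have rH t : unit_interval t -> r t = H (clamp s, t).
    by move=> It; rewrite /= /cl /= (clamp_id It).
  apply: (step (clamp s) (clamp s') r q) => //;
    [exact: clamp_unit_interval..| |exact: Ps].
  move=> t It; have := close t It.
  by rewrite rH // qH // /= /cl /= (clamp_id It).
(* Changing the representative of the slice at 0 is itself a step from 0 to 0, each matrix being
   near itself. *)
move=> q qH; have I0 := @unit_interval0 R.
apply: (step 0 0 p q) => // t It; first by rewrite qH // clamp0.
by rewrite (_ : q t = p t); [exact: near_self|rewrite qH // clamp0 pH].
Qed.

(** The initial segments t -> g (s t) form a family joining the constant path to [g]. *)
Lemma path_ind (Phi : SL2_path R -> Prop) :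
  Phi (path_one R) ->
  (forall p p' : SL2_path R, (forall t, unit_interval t -> near_mx (p t) (p' t)) ->
    Phi p -> Phi p') ->
  forall g, Phi g.
Proof.
move=> Phi1 step g.
pose H (z : R * R) := g (clamp (clamp z.1 * clamp z.2)).
have cH : continuous H.
  move=> z; apply: (continuous_comp (f := fun z : R * R => clamp z.1 * clamp z.2)
    (g := g \o @clamp R)); last exact: path_clamp_continuous.
  by apply: cvgM; apply: continuous_comp; [exact: fst_continuous|
    exact: continuous_clamp|exact: snd_continuous|exact: continuous_clamp].
have dH z : \det (H z) = 1 by apply: path_det; exact: clamp_unit_interval.
apply: (@family_ind H Phi _ _ _ (path_one R) g) => //.
- exact: SL2_valued_continuous.
- by move=> s _; rewrite /H /= clamp0 mulr0 clamp0 path_start.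
- by move=> s s' p p' _ _ _ _; exact: step.
- by move=> t _; rewrite /H /= clamp0 mul0r clamp0 path_start.
- by move=> t It; rewrite /H /= clamp1 mul1r !clamp_id.
Qed.

Lemma mx2_continuous (T : topologicalType) (a b c d : T -> R) :
  continuous a -> continuous b -> continuous c -> continuous d ->
  continuous (fun x => mx2 (a x) (b x) (c x) (d x)).
Proof.
move=> ca cb cc cd; apply/mx_continuousP => i j.
by elim/ord2P: i; elim/ord2P: j => x; under eq_fun do rewrite mxE /=;
  [exact: ca|exact: cb|exact: cc|exact: cd].
Qed.

(** * Lifted unipotent one-parameter groups *)

Definition shear (b : bool) (x : R) : 'M[R]_2 :=
  if b then mx2 1 x 0 1 else mx2 1 0 x 1.

Lemma shear0 b : shear b 0 = 1%:M.
Proof. by case: b; rewrite /shear mx2_1. Qed.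

Lemma shearD b x y : shear b x *m shear b y = shear b (x + y).
Proof. by case: b; rewrite /shear mulmx2; congr mx2; ring. Qed.

Lemma det_shear b x : \det (shear b x) = 1.
Proof. by case: b; rewrite /shear det_mx2; ring. Qed.

Lemma shear_continuous (T : topologicalType) b (f : T -> R) :
  continuous f -> continuous (fun x => shear b (f x)).
Proof.
by move=> cf; case: b; apply: mx2_continuous => //; exact: cst_continuous.
Qed.

Lemma shear_start b (f : R -> R) : f 0 = 0 -> shear b (f 0) = 1%:M.
Proof. by move=> ->; exact: shear0. Qed.

Definition shear_path b (f : R -> R) (cf : continuous f) (f0 : f 0 = 0) :=
  path_of (shear_continuous (b := b) cf) (fun t => det_shear b (f t))
    (shear_start b f0).

Lemma mulr_continuous (s : R) : continuous (fun t : R => t * s).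
Proof. by move=> t; apply: cvgM; [exact: cvg_id|exact: cvg_cst]. Qed.

Definition cover_shear b s : cover :=
  path_class (shear_path b (@mulr_continuous s) (mul0r s)).

(** The parameter ranges over a line, so the straight-line homotopy from [f] to t -> t f(1) stays
    among shears of the same kind. *)
Lemma shear_path_class b f (cf : continuous f) (f0 : f 0 = 0) :
  path_class (shear_path b cf f0) = cover_shear b (f 1).
Proof.
apply/path_classP.
exists (fun z => shear b ((1 - z.1) * f z.2 + z.1 * (z.2 * f 1))).
split=> [|t _|t _|s _|s _] /=;
  rewrite ?subr0 ?subrr ?mul0r ?mul1r ?mulr0 ?add0r ?addr0 //.
- apply: SL2_valued_continuous => [|z]; last exact: det_shear.
  apply: shear_continuous => z; apply: cvgD; apply: cvgM.
  + by apply: cvgB; [exact: cvg_cst|exact: fst_continuous].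
  + by apply: continuous_comp; [exact: snd_continuous|exact: cf].
  + exact: fst_continuous.
  + by apply: cvgM; [exact: snd_continuous|exact: cvg_cst].
- by rewrite f0 mulr0 shear0.
- by congr shear; ring.
Qed.

Lemma cover_shearD b x y :
  (cover_shear b x * cover_shear b y)%g = cover_shear b (x + y).
Proof.
rewrite path_classM; apply: eq_path_class => t _ /=.
by rewrite shearD -mulrDr.
Qed.

Lemma cover_shearN b x : cover_shear b (- x) = (cover_shear b x)^-1%g.
Proof.
apply: (mulgI (cover_shear b x)); rewrite mulgV cover_shearD subrr.
by apply: eq_path_class => t _ /=; rewrite mulr0 shear0.
Qed.

(* The identity [a - 1 = (p + q) (p - q)], where [p] and [q] are the square
   roots of the positive and negative parts of [a - 1], makes all four factors
   continuous and trivial at the identity. *)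
Lemma SL2_shear_decomposition (A : 'M[R]_2) :
  \det A = 1 -> A 0 0 != 0 ->
  let p := Num.sqrt (A 0 0 - 1) in let q := Num.sqrt (1 - A 0 0) in
  A = shear false ((A 1 0 - (p - q)) / A 0 0) *m shear true (p + q)
      *m shear false (p - q) *m shear true ((A 0 1 - (p + q)) / A 0 0).
Proof.
move=> dA a0 p q.
have pq : (p + q) * (p - q) = A 0 0 - 1.
  rewrite mulrC -subr_sqr /p /q; case: (lerP 1 (A 0 0)) => a1.
    rewrite sqr_sqrtr ?subr_ge0 // [Num.sqrt (1 - _)]ler0_sqrtr ?subr_le0 //.
    by rewrite expr0n subr0.
  rewrite [Num.sqrt (_ - 1)]ler0_sqrtr ?subr_le0 1?ltW // expr0n /= sub0r.
  by rewrite sqr_sqrtr ?subr_ge0 1?ltW // opprB.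
move: (p + q) (p - q) pq => {p q} y z yz.
rewrite {1}(mx2_eta A) /shear !mulmx2.
have -> : A 1 1 = (1 + A 0 1 * A 1 0) / A 0 0.
  by rewrite -dA det2E; field.
move: (A 0 0) (A 0 1) (A 1 0) a0 yz => a b c a0 yz.
have -> : a = 1 + y * z by rewrite yz; ring.
have {}a0 : 1 + y * z != 0 by rewrite yz addrC subrK.
by congr mx2; field.
Qed.

(** By [path_ind] it suffices to pass from [g] to a nearby [g']. The path [k] = g^-1 g' then has a
    nonzero corner entry throughout, so it factors continuously into four shear paths. *)
Lemma cover_generated (B : set cover) :
  is_subgroup B -> (forall b s, B (cover_shear b s)) -> B = setT.
Proof.
move=> [B1 BM BV] Bshear; apply/seteqP; split=> // x _.
rewrite -(path_class_repr x); move: (repr x).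
apply: path_ind => [//|g g' close Bg].
suff Bk : B (path_class (path_mul (path_inv g) g')).
  rewrite (_ : path_class g' =
    path_class g * path_class (path_mul (path_inv g) g'))%g; first exact: BM.
  by rewrite -path_classM -path_classV mulVKg.
pose k t := invmx (g (clamp t)) *m g' (clamp t).
have It := @clamp_unit_interval R.
have k00 t : k t 0 0 != 0.
  rewrite /k mulmx2E invmx2 ?path_det // !mxE /= mulNr.
  by have [+ _ _] := close (clamp t) (It t); exact: lt0r_neq0.
have dk t : \det (k t) = 1 by rewrite det_mulmx det_inv !path_det // invr1 mulr1.
have ck i j : continuous (fun t => k t i j).
  have /mx_continuousP := @path_clamp_continuous (path_mul (path_inv g) g').
  exact.
have k0 : k 0 = 1%:M by rewrite /k clamp0 !path_start invmx1 mulmx1.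
pose p t := Num.sqrt (k t 0 0 - 1); pose q t := Num.sqrt (1 - k t 0 0).
have cp : continuous p.
  move=> t; apply: (continuous_comp (f := fun t => k t 0 0 - 1)).
    by apply: cvgB; [exact: ck|exact: cvg_cst].
  exact: sqrt_continuous.
have cq : continuous q.
  move=> t; apply: (continuous_comp (f := fun t => 1 - k t 0 0)).
    by apply: cvgB; [exact: cvg_cst|exact: ck].
  exact: sqrt_continuous.
have p0 : p 0 = 0 by rewrite /p k0 mxE eqxx subrr sqrtr0.
have q0 : q 0 = 0 by rewrite /q k0 mxE eqxx subrr sqrtr0.
have cx : continuous (fun t => (k t 1 0 - (p t - q t)) / k t 0 0).
  move=> t; apply: cvgM; last by apply: cvgV; [exact: k00|exact: ck].
  by apply: cvgB; [exact: ck|apply: cvgB; [exact: cp|exact: cq]].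
have cw : continuous (fun t => (k t 0 1 - (p t + q t)) / k t 0 0).
  move=> t; apply: cvgM; last by apply: cvgV; [exact: k00|exact: ck].
  by apply: cvgB; [exact: ck|apply: cvgD; [exact: cp|exact: cq]].
have cy : continuous (fun t => p t + q t).
  by move=> t; apply: cvgD; [exact: cp|exact: cq].
have cz : continuous (fun t => p t - q t).
  by move=> t; apply: cvgB; [exact: cp|exact: cq].
have x0 : (k 0 1 0 - (p 0 - q 0)) / k 0 0 0 = 0.
  by rewrite k0 !mxE p0 q0 /= !subr0 mul0r.
have w0 : (k 0 0 1 - (p 0 + q 0)) / k 0 0 0 = 0.
  by rewrite k0 !mxE p0 q0 /= addr0 subr0 mul0r.
have y0 : p 0 + q 0 = 0 by rewrite p0 q0 addr0.
have z0 : p 0 - q 0 = 0 by rewrite p0 q0 subr0.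
rewrite (_ : path_class _ = path_class (shear_path false cx x0) *
  path_class (shear_path true cy y0) * path_class (shear_path false cz z0) *
  path_class (shear_path true cw w0))%g.
  by rewrite !shear_path_class; apply: BM (BM _ _ (BM _ _ _ _) _) _; exact: Bshear.
rewrite !path_classM; apply: eq_path_class => t It01.
rewrite [RHS]/= -(SL2_shear_decomposition (dk t) (k00 t)).
by rewrite /= /k (clamp_id It01).
Qed.

(** * The lifted diagonal torus and its action on unipotents *)

Let scale (n : nat) (t : R) : R := 1 + clamp t * n%:R.

Let scale_gt0 n t : 0 < scale n t.
Proof.
rewrite /scale ltr_pwDl // mulr_ge0 //.
by have := clamp_unit_interval t; rewrite /unit_interval /= in_itv => /andP[].
Qed.

Let scale_neq0 n t : scale n t != 0.
Proof. exact/lt0r_neq0/scale_gt0. Qed.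

Let scale_continuous n : continuous (scale n).
Proof.
move=> t; apply: cvgD; first exact: cvg_cst.
by apply: cvgM; [exact: continuous_clamp|exact: cvg_cst].
Qed.

Let scale_start n : mx2 (scale n 0) 0 0 (scale n 0)^-1 = 1%:M.
Proof. by rewrite mx2_1 /scale clamp0 mul0r addr0 invr1. Qed.

Let torus_det n t : \det (mx2 (scale n t) 0 0 (scale n t)^-1) = 1.
Proof. by rewrite det_mx2 mulr0 subr0 divff. Qed.

Let scaleV_continuous n : continuous (fun t => (scale n t)^-1).
Proof. by move=> t; apply: cvgV; [exact: scale_neq0|exact: scale_continuous]. Qed.

Definition torus_path (n : nat) : SL2_path R :=
  path_of (mx2_continuous (@scale_continuous n) (fun=> cvg_cst _) (fun=> cvg_cst _)
    (@scaleV_continuous n)) (torus_det n) (scale_start n).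

(** The factor by which conjugation by diag(n+1, 1/(n+1)), the endpoint of [torus_path n], rescales
    upper shears ([true]) or lower shears ([false]). *)
Definition torus_weight (b : bool) (n : nat) : R :=
  if b then n.+1%:R ^+ 2 else n.+1%:R ^- 2.

Lemma torus_weight_inj b : injective (torus_weight b).
Proof.
have sq_inj m n : m.+1%:R ^+ 2 = n.+1%:R ^+ 2 :> R -> m = n.
  move=> /eqP; rewrite eqrXn2 ?ler0n // eqr_nat => /eqP; exact: succn_inj.
by case: b => m n; rewrite /torus_weight; [|move=> /invr_inj]; exact: sq_inj.
Qed.

Lemma torus_weight_neq0 b n : torus_weight b n != 0.
Proof. by case: b; rewrite /torus_weight ?invr_eq0 expf_neq0 ?pnatr_eq0. Qed.

(** The relation holds pointwise along the paths with the shear parameter [f], and by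
    [shear_path_class] only the value [f 1] matters. *)
Lemma torus_shear b n x :
  (path_class (torus_path n) * cover_shear b x =
   cover_shear b (torus_weight b n * x) * path_class (torus_path n))%g.
Proof.
pose f t := t * x * (if b then scale n t ^+ 2 else scale n t ^- 2).
have cs2 : continuous (fun t => scale n t ^+ 2).
  by move=> t; rewrite /continuous_at; under eq_fun do rewrite expr2;
    apply: cvgM; exact: scale_continuous.
have cf : continuous f.
  move=> t; apply: cvgM; first exact: mulr_continuous.
  by case: (b); [exact: cs2|apply: cvgV; [rewrite expf_neq0|exact: cs2]].
have f0 : f 0 = 0 by rewrite /f !mul0r.
rewrite (_ : torus_weight b n * x = f 1).
  rewrite -(shear_path_class b cf f0) !path_classM; apply: eq_path_class => t _ /=.
  have := scale_neq0 n t; rewrite /f /shear; case: (b); rewrite !mulmx2 => s0;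
  by congr mx2; field.
rewrite /f /torus_weight /scale clamp1 !mul1r nat1r.
by rewrite mulrC.
Qed.

(** Conjugation by [w] multiplies shear parameters by some [l] different from 1. So, for u the shear
    with parameter t, the commutator w^-1 u^-1 w u is the shear with parameter (1 - l) t, and t is
    chosen to make this s. *)
Lemma cover_shear_coloured b s (N : set cover) :
  finitely_coloured N -> conj_invariant N ->
  exists a a', [/\ N a, N a' & cover_shear b s = (a^-1 * a')%g].
Proof.
move=> [T [c colN]] conjN.
pose h (i : 'I_#|T|.+1) := path_class (torus_path i).
have /injectivePn[i [j ij hij]] : ~~ injectiveb (c \o h).
  apply/negP => /injectiveP/leq_card; rewrite card_ord ltnn //.
pose w := ((h i)^-1 * h j)%g; have Nw : N w by exact: colN.
pose l := torus_weight b i / torus_weight b j.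
have wshear t : (w^-1 * cover_shear b t * w = cover_shear b (l * t))%g.
  have hshear (k : 'I_#|T|.+1) x : (h k * cover_shear b x * (h k)^-1 =
      cover_shear b (torus_weight b k * x))%g.
    by rewrite torus_shear mulgK.
  rewrite /w invgM invgK; apply: (mulgI (h j)); apply: (mulIg (h j)^-1%g).
  rewrite hshear mulrA mulrCA divff ?torus_weight_neq0 // mulr1 -hshear.
  by rewrite -!mulgA mulVKg mulgV mulg1.
have l1 : 1 - l != 0.
  rewrite subr_eq0 eq_sym -subr_eq0 -[X in _ - X](divff (torus_weight_neq0 b j)) -mulrBl.
  rewrite mulf_neq0 ?invr_eq0 ?torus_weight_neq0 // subr_eq0.
  by apply/eqP => /torus_weight_inj /val_inj /eqP; apply/negP.
clearbody w; pose t := s / (1 - l).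
exists w, ((cover_shear b t)^-1 * w * cover_shear b t)%g; split => //; first exact: conjN.
rewrite -cover_shearN !mulgA wshear cover_shearD; congr cover_shear.
by rewrite /t; field.
Qed.

Lemma cover_type_absolutely_connected : type_absolutely_connected cover.
Proof.
apply: type_absolutely_connected_chain => V colV divV.
apply: (chain_generated colV divV (X := [set x | exists b s, x = cover_shear b s])).
  by move=> x N [b [s ->]] colN conjN; exact: cover_shear_coloured.
by move=> B subB XB; apply: cover_generated => // b s; apply: XB; exists b, s.
Qed.

End CoverGeneration.

(** * The angle quasimorphism *)

Section Quasimorphism.
Local Open Scope ring_scope.

Lemma quasimorphism_not_absolutely_connected (R : realType) (G : groupType)
    (q : G -> R) (C : R) :
  (forall x y, `|q (x * y)%g - q x - q y| <= C) ->
  (forall r, exists x, q x = r) -> ~ absolutely_connected G.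
Proof.
move=> qM q_surj [n conn].
have C0 : 0 <= C by exact: le_trans (qM 1%g 1%g).
have q1 : `|q 1%g| <= C by have := qM 1%g 1%g; rewrite mulg1 subrr sub0r normrN.
have qV x : `|q x^-1%g + q x| <= 2 * C.
  have := qM x^-1%g x; rewrite mulVg; move: q1; rewrite !ler_norml; lra.
have qdiv a b : `|q (a^-1 * b)%g - (q b - q a)| <= 3 * C.
  by have := qM a^-1%g b; have := qV a; rewrite !ler_norml; lra.
(* In [E], 1 is the rounding error of the floors and 3 C comes from [qdiv]. In [bound], C accounts
   for the empty product and E + C for each of the n factors. *)
pose E := 1 + 3 * C; pose bound := C + n%:R * (E + C).
pose m := (Num.bound (2 * bound)).+1.
have E0 : 0 <= E by rewrite /E; lra.
have bound0 : 0 <= bound by rewrite /bound addr_ge0 // mulr_ge0 // addr_ge0.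
have mb : 2 * bound < m%:R :> R.
  apply: lt_trans (archi_boundP _) _; first by rewrite mulr_ge0.
  by rewrite ltr_nat.
pose near (e : R) x := exists k : int, `|q x - k%:~R * m%:R| <= e.
(* As [q] is odd only up to an error, symmetry has to be imposed. *)
pose P := [set x | near E x /\ near E x^-1%g].
pose colour x : 'I_m := inord `|(Num.floor (q x) %% m)%Z|%N.
have near_div a b : colour a = colour b -> near E (a^-1 * b)%g.
  have lt_m x : (`|(Num.floor (q x) %% m)%Z| < m)%N.
    by rewrite -ltz_nat gez0_abs ?modz_ge0 ?ltz_pmod.
  move=> /(congr1 val); rewrite /= !inordK // => ab.
  have {}ab : (Num.floor (q a) %% m = Num.floor (q b) %% m)%Z.
    by rewrite -[LHS]gez0_abs ?modz_ge0 // ab gez0_abs ?modz_ge0.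
  (* The two floors have equal remainders modulo [m], so they differ by exactly this multiple of
     [m]. *)
  exists ((Num.floor (q b) %/ m)%Z - (Num.floor (q a) %/ m)%Z).
  have := floor_itv (q a); have := floor_itv (q b).
  have := congr1 (fun z : int => z%:~R : R) (divz_eq (Num.floor (q a)) m).
  have := congr1 (fun z : int => z%:~R : R) (divz_eq (Num.floor (q b)) m).
  rewrite ab !rmorphB /= !rmorphD /= !rmorphM /= => ea eb /andP[b1 b2] /andP[a1 a2].
  have := qdiv a b; rewrite !ler_norml /E; lra.
have thickP : thick P.
  exists m.+1; split=> [|g].
    by apply/seteqP; split=> x /= [Px Px']; split; rewrite ?invgK // -[x]invgK.
  have /injectivePn[i [j ij cij]] : ~~ injectiveb (colour \o g).
    by apply/negP => /injectiveP/leq_card; rewrite !card_ord ltnn.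
  have Pdiv a b : colour a = colour b -> P (a^-1 * b)%g.
    by move=> ab; split; rewrite ?invgM ?invgK; exact: near_div.
  have [ltij|leji] := ltnP i j; first by exists i, j; split=> //; exact: Pdiv.
  exists j, i; split; last exact: Pdiv.
  by rewrite ltn_neqAle leji andbT eq_sym.
have near_prod k (p : 'I_k -> G) : (forall i, P (p i)) ->
    near (C + k%:R * (E + C)) (\prod_(i < k) p i)%g.
  elim: k p => [|k IH] p Pp.
    by rewrite big_ord0; exists 0; rewrite mul0r subr0 mul0r addr0.
  rewrite big_ord_recl; have [l Hl] := IH _ (fun i => Pp (lift ord0 i)).
  have [[l' Hl'] _] := Pp ord0; exists (l' + l); move: Hl Hl'.
  have := qM (p ord0) (\prod_(i < k) p (lift ord0 i))%g.
  rewrite !ler_norml rmorphD /= -natr1; lra.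
have [x qx] := q_surj (m%:R / 2).
have : set_power P n x by rewrite conn.
move=> [p [Pp xp]]; have [k] := near_prod n p Pp; rewrite -xp qx -/bound.
(* The number m / 2 has distance at least m / 2 from every multiple of m, which exceeds [bound]. *)
have [k0|k1] := lerP k 0.
  have : k%:~R <= 0 :> R by rewrite lerz0.
  rewrite ler_norml; nra.
have : 1 <= k%:~R :> R by rewrite ler1z.
rewrite ler_norml; nra.
Qed.

End Quasimorphism.

(** * Lifting the argument of the first column *)

Section CoverAngle.
Local Open Scope ring_scope.
Variable R : realType.
Local Notation cover := (SL2_universal_cover R).

Definition angle_lift (g : SL2_path R) (theta : R -> R) : Prop :=
  [/\ continuous theta, theta 0 = 0 &
      forall t, unit_interval t -> exists r, [/\ 0 < r,
        g t 0 0 = r * cos (theta t) & g t 1 0 = r * sin (theta t)]].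

(** The angle between the first columns of [g] and [h] is atan (N / D), with N their cross product
    and D their dot product, positive by [near_mx]. It vanishes wherever the two matrices agree. *)
Lemma angle_lift_step (g h : SL2_path R) theta :
  (forall t, unit_interval t -> near_mx (g t) (h t)) -> angle_lift g theta ->
  exists2 eta, angle_lift h eta & g 1 = h 1 -> eta 1 = theta 1.
Proof.
move=> close [ctheta theta0 gtheta].
pose N t := g (clamp t) 0 0 * h (clamp t) 1 0 - g (clamp t) 1 0 * h (clamp t) 0 0.
pose D t := g (clamp t) 0 0 * h (clamp t) 0 0 + g (clamp t) 1 0 * h (clamp t) 1 0.
have D0 t : 0 < D t by have [] := close _ (clamp_unit_interval t).
have cg i j : continuous (fun t => g (clamp t) i j).
  by have /mx_continuousP := @path_clamp_continuous R g; exact.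
have ch i j : continuous (fun t => h (clamp t) i j).
  by have /mx_continuousP := @path_clamp_continuous R h; exact.
have cN : continuous N.
  by move=> t; apply: cvgB; apply: cvgM; [exact: cg|exact: ch|exact: cg|exact: ch].
have cD : continuous D.
  by move=> t; apply: cvgD; apply: cvgM; [exact: cg|exact: ch|exact: cg|exact: ch].
have NE t : g (clamp t) = h (clamp t) -> N t = 0 by rewrite /N => ->; ring.
exists (fun t => theta t + atan (N t / D t)); last first.
  by move=> gh1; rewrite NE ?clamp1 // mul0r atan0 addr0.
split.
- move=> t; apply: cvgD; first exact: ctheta.
  apply: (continuous_comp (f := fun t => N t / D t)); last exact: continuous_atan.
  by apply: cvgM; [exact: cN|apply: cvgV; [exact: lt0r_neq0|exact: cD]].
- by rewrite NE ?clamp0 ?path_start // mul0r atan0 addr0.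
move=> t It; have [r [r0 ga gc]] := gtheta t It.
set a := atan _.
have ca0 : 0 < cos a by apply: cos_gt0_pihalf; rewrite atan_gtNpi2 atan_ltpi2.
have sa : sin a * D t = N t * cos a.
  have : tan a = N t / D t by exact: atanK.
  rewrite /tan => /eqP; rewrite eqr_div ?lt0r_neq0 // => /eqP ->; ring.
(* The new radius r' is read off from the dot product D = r r' cos a. *)
exists (D t / (r * cos a)); split; first by rewrite divr_gt0 // mulr_gt0.
all: have c2 := cos2Dsin2 (theta t).
all: have nz1 := lt0r_neq0 r0; have nz2 := lt0r_neq0 ca0.
  rewrite cosD [RHS](_ : _ = (cos (theta t) * D t * cos a - sin (theta t) * (sin a * D t))
    / (r * cos a)); last by field; rewrite ?nz1 ?nz2.
  rewrite sa /D /N clamp_id // ga gc.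
  by rewrite -[LHS]mulr1 -c2; field; rewrite ?nz1 ?nz2.
rewrite sinD [RHS](_ : _ = (sin (theta t) * D t * cos a + cos (theta t) * (sin a * D t))
    / (r * cos a)); last by field; rewrite ?nz1 ?nz2.
rewrite sa /D /N clamp_id // ga gc.
by rewrite -[LHS]mulr1 -c2; field; rewrite ?nz1 ?nz2.
Qed.

Lemma angle_lift_exists (g : SL2_path R) : exists theta, angle_lift g theta.
Proof.
move: g; apply: path_ind => [|g h close [theta gtheta]].
  exists (fun=> 0); split=> // [|t _]; first exact: cst_continuous.
  by exists 1; rewrite ltr01 !mxE /= cos0 sin0 mulr1 mulr0.
by have [eta heta _] := angle_lift_step close gtheta; exists eta.
Qed.

(** All slices of the homotopy end at [g 1], so each step of the continuation keeps the final
    angle. *)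
Lemma angle_lift_homotopic (g h : SL2_path R) theta : homotopic g h ->
  angle_lift g theta -> exists2 eta, angle_lift h eta & eta 1 = theta 1.
Proof.
move=> [H [VH H0 H1 Hs He]] gtheta.
apply: (@family_ind R H (fun p => exists2 eta, angle_lift p eta & eta 1 = theta 1)
  VH Hs _ g h) => [s s' p p' Is Is' pH p'H close [eta peta eta1]|t It|t It|].
- have [eta' p'eta' eta'1] := angle_lift_step close peta.
  exists eta' => //; rewrite eta'1 // pH ?p'H; try exact: unit_interval1.
  by rewrite !He.
- by rewrite H0.
- by rewrite H1.
- by exists theta.
Qed.

(** By the intermediate value theorem, |f| cannot get from 0 to v or beyond without taking the value
    v. *)
Lemma continuous_avoid (f : R -> R) v : continuous f -> f 0 = 0 -> 0 < v ->
  (forall t, unit_interval t -> `|f t| != v) -> `|f 1| < v.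
Proof.
move=> cf f0 v0 avoid; rewrite ltNge; apply/negP => vf1.
have [||t It /eqP ft] := @IVT R (fun t => `|f t|) 0 1 v ler01.
- by apply: continuous_subspaceT => t; apply: cvg_norm; exact: cf.
- by rewrite f0 normr0 min_l // max_r // vf1 ltW.
by have /negP := avoid t It; apply.
Qed.

(** The difference [d] of two lifts has zero sine, so |d| takes no value strictly between 0 and pi
    and cannot leave 0. *)
Lemma angle_lift_unique (g : SL2_path R) theta eta :
  angle_lift g theta -> angle_lift g eta -> theta 1 = eta 1.
Proof.
move=> [ctheta theta0 gtheta] [ceta eta0 geta].
pose d t := theta t - eta t.
have sind t : unit_interval t -> sin (d t) = 0.
  move=> It; have [r [r0 ra rc]] := gtheta t It; have [s [s0 sa sc]] := geta t It.
  apply: (mulfI (lt0r_neq0 (mulr_gt0 r0 s0))); rewrite mulr0 sinB.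
  rewrite (_ : _ * _ = (r * sin (theta t)) * (s * cos (eta t))
    - (r * cos (theta t)) * (s * sin (eta t))); last by ring.
  by rewrite -ra -rc -sa -sc; ring.
apply/eqP; rewrite -subr_eq0 -normr_eq0 -/(d 1); apply/negP => /negP.
rewrite -normr_gt0 normr_id => d1.
have pi0 := pi_gt0 R.
(* A value below pi and at most |d 1|: avoiding it gives the contradiction |d 1| < v <= |d 1|. *)
pose v := Num.min `|d 1| (pi / 2).
have v0 : 0 < v by rewrite lt_min d1 divr_gt0.
have : `|d 1| < v.
  apply: continuous_avoid => //.
  - by move=> t; apply: cvgB; [exact: ctheta|exact: ceta].
  - by rewrite /d theta0 eta0 subrr.
  move=> t It; apply/eqP => dv.
  have : 0 < sin `|d t|.
    rewrite dv sin_gt0_pi // v0 /=.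
    by apply: (@le_lt_trans _ _ (pi / 2)); [rewrite ge_min lexx orbT|lra].
  have [_|_] := ger0P (d t); rewrite ?sinN sind // ?oppr0 ltxx //.
by rewrite ltNge ge_min lexx.
Qed.

(* Up to the rotation by [theta], [g t] is upper triangular with positive
   diagonal, so it sends no vector to a negative multiple of itself. *)
Lemma angle_lift_mul (g h : SL2_path R) theta eta zeta :
  angle_lift g theta -> angle_lift h eta -> angle_lift (path_mul g h) zeta ->
  `|zeta 1 - theta 1 - eta 1| < pi.
Proof.
move=> [ctheta theta0 gtheta] [ceta eta0 heta] [czeta zeta0 ghzeta].
pose d t := zeta t - theta t - eta t.
apply: (@continuous_avoid d) (pi_gt0 R) _.
- move=> t; apply: cvgB; last exact: ceta.
  by apply: cvgB; [exact: czeta|exact: ctheta].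
- by rewrite /d zeta0 theta0 eta0 !subrr.
move=> t It; apply/eqP => dpi.
have [r [r0 ga gc]] := gtheta t It; have [s [s0 ha hc]] := heta t It.
have [u [u0]] := ghzeta t It; rewrite /= !mulmx2E ha hc.
have := path_det g It; rewrite det2E ga gc.
move: (g t 0 1) (g t 1 1) => b e det1.
have [cd sd] : cos (d t) = -1 /\ sin (d t) = 0.
  move: dpi; have [_ ->|_ /eqP] := ger0P (d t); first by rewrite cospi sinpi.
  by rewrite eqr_oppLR => /eqP ->; rewrite cosN sinN cospi sinpi oppr0.
have -> : zeta t = theta t + (eta t + d t) by rewrite /d; ring.
have ced : cos (eta t + d t) = - cos (eta t) by rewrite cosD cd sd; ring.
have sed : sin (eta t + d t) = - sin (eta t) by rewrite sinD cd sd; ring.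
rewrite cosD ced sed sinD ced sed => ea ec.
have c2 := cos2Dsin2 (theta t); have e2 := cos2Dsin2 (eta t).
move: (cos (theta t)) (sin (theta t)) (cos (eta t)) (sin (eta t)) det1 ea ec c2 e2.
move=> C S C' S' det1 ea ec c2 e2.
(* Second coordinate after rotating back by theta: the diagonal entry there is 1 / r, so s S' / r =
   - u S'. *)
have S'0 : S' = 0.
  have : S' * (s / r + u) = 0.
    apply: (mulfI (lt0r_neq0 r0)); rewrite mulr0.
    have -> : r * (S' * (s / r + u)) = s * S' * 1 + r * u * S' * 1.
      by field; exact: lt0r_neq0.
    rewrite -{1}det1 -c2.
    have : r * (C * (r * S * (s * C') + e * (s * S'))
              - S * (r * C * (s * C') + b * (s * S')))
           = - (r * u * S' * (C ^+ 2 + S ^+ 2)) by rewrite ea ec; ring.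
    by move=> E; apply/eqP; rewrite addr_eq0 -E; apply/eqP; ring.
  move=> /eqP; rewrite mulf_eq0 (gt_eqF (addr_gt0 (divr_gt0 s0 r0) u0)) orbF.
  exact/eqP.
(* First coordinate, with diagonal entry r: now r s C' = - u C'. *)
have C'0 : C' = 0.
  have : C' * (r * s + u) = 0.
    rewrite S'0 in ea ec; rewrite -[LHS]mulr1 -c2.
    have E : C * (r * C * (s * C') + b * (s * 0)) + S * (r * S * (s * C') + e * (s * 0))
           = - (u * C' * (C ^+ 2 + S ^+ 2)) by rewrite ea ec; ring.
    have -> : C' * (r * s + u) * (C ^+ 2 + S ^+ 2) = r * s * C' * (C ^+ 2 + S ^+ 2)
      - - (u * C' * (C ^+ 2 + S ^+ 2)) by ring.
    by rewrite -E; ring.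
  move=> /eqP; rewrite mulf_eq0 (gt_eqF (addr_gt0 (mulr_gt0 r0 s0) u0)) orbF.
  exact/eqP.
by move: e2; rewrite S'0 C'0 expr0n addr0 => /eqP; rewrite eq_sym oner_eq0.
Qed.

Definition cover_angle (x : cover) : R :=
  xget 0 [set a | exists2 theta, angle_lift (repr x) theta & theta 1 = a].

(** A lift along [g] transfers to the chosen representative with the same final angle, and
    uniqueness of lifts removes the choice made by [xget]. *)
Lemma cover_angleE g theta : angle_lift g theta ->
  cover_angle (path_class g) = theta 1.
Proof.
move=> gtheta.
have /(angle_lift_homotopic) /(_ gtheta)[eta peta eta1] :
    homotopic g (repr (path_class g)).
  by apply/path_classP; rewrite path_class_repr.
rewrite /cover_angle; case: xgetP => [_ -> [eta' peta' <-]|/(_ (eta 1))].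
  by rewrite (angle_lift_unique peta' peta).
by case; exists eta.
Qed.

Lemma cover_angleM (x y : cover) :
  `|cover_angle (x * y)%g - cover_angle x - cover_angle y| <= pi.
Proof.
rewrite -(path_class_repr x) -(path_class_repr y); move: (repr x) (repr y) => g h.
have [theta gtheta] := angle_lift_exists g; have [eta heta] := angle_lift_exists h.
have [zeta ghzeta] := angle_lift_exists (path_mul g h).
rewrite path_classM (cover_angleE gtheta) (cover_angleE heta) (cover_angleE ghzeta).
exact: ltW (angle_lift_mul gtheta heta ghzeta).
Qed.

Lemma cover_angle_surj r : exists x : cover, cover_angle x = r.
Proof.
have cr := @mulr_continuous R r.
have csin : continuous (fun t : R => sin (t * r)).
  by move=> t; apply: continuous_comp; [exact: cr|exact: continuous_sin].
have ccos : continuous (fun t : R => cos (t * r)).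
  by move=> t; apply: continuous_comp; [exact: cr|exact: continuous_cos].
have cNsin : continuous (fun t : R => - sin (t * r)).
  by move=> t; apply: cvgN; exact: csin.
have drot t : \det (mx2 (cos (t * r)) (- sin (t * r)) (sin (t * r)) (cos (t * r))) = 1.
  by rewrite det_mx2 -[RHS](cos2Dsin2 (t * r)); ring.
have rot0 : mx2 (cos (0 * r)) (- sin (0 * r)) (sin (0 * r)) (cos (0 * r)) = 1%:M.
  by rewrite mul0r cos0 sin0 oppr0 mx2_1.
pose rot := path_of (mx2_continuous ccos cNsin csin ccos) drot rot0.
exists (path_class rot); rewrite (@cover_angleE _ (fun t => t * r)) ?mul1r //.
split=> // [|t _]; first by rewrite mul0r.
by exists 1; rewrite ltr01 !mxE /= !mul1r.
Qed.

End CoverAngle.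

Theorem corollary5p13 (R : realType) :
  type_absolutely_connected (SL2_universal_cover R) /\
  ~ absolutely_connected (SL2_universal_cover R).
Proof.
split; first exact: cover_type_absolutely_connected.
exact: quasimorphism_not_absolutely_connected (@cover_angleM R) (@cover_angle_surj R).
Qed.
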